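(* Let $T>0$. For every $\varepsilon>0$ there is a constant $C_\varepsilon$, with $\lim_{\varepsilon\to0}C_\varepsilon=+\infty$, such that for every integer $N\ge1$, every $t\in[0,T]$ and every $\mu\in S_N\setminus\left(\frac12-\varepsilon,\frac12+\varepsilon\right)$, $$|V^N(t,\mu)-U^*(t,\mu)|\le\frac{C_\varepsilon}{N};$$ in particular $C_\varepsilon$ does not depend on $N$, $t$ or $\mu$. Here $S_N=\{0,\frac1N,\dots,1\}$, $V^N$ is the value function of the $(N+1)$-player game and $U^*$ is the function obtained from the entropy solution of the master equation, both defined in the context.
   Context: Notation: $p^-=\max(-p,0)$, $p^+=\max(p,0)$, $H(p)=\frac{(p^-)^2}{2}$. The $(N+1)$-player game: players have states in $\{-1,1\}$; each controls in feedback form the rate $a\ge0$ at which she/he flips state, pays running cost $a^2/2$ and terminal cost $-x(2\mu-1)$, with $x$ the final state and $\mu\in S_N$ the fraction of the other $N$ players in state $1$ at time $T$. $V^N:[0,T]\times S_N\to[-1,1]$, the equilibrium value of a player in state $1$ when a fraction $\mu$ of the others is in state $1$, is the unique solution of $$-\frac{d}{dt}V^N(t,\mu)+H\big(V^N(t,1-\mu)-V^N(t,\mu)\big)=N\mu\,\big[V^N(t,1-\mu)-V^N(t,\mu)\big]^-\Big[V^N\big(t,\mu-\tfrac1N\big)-V^N(t,\mu)\Big]$$ $$\qquad+N(1-\mu)\Big[V^N\big(t,\mu+\tfrac1N\big)-V^N\big(t,1-\mu-\tfrac1N\big)\Big]^-\Big[V^N\big(t,\mu+\tfrac1N\big)-V^N(t,\mu)\Big],$$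 $$V^N(T,\mu)=-(2\mu-1),$$ where terms with vanishing prefactor are read as $0$. The limit: for $t\ge0$ and $m\in[-1,1]\setminus\{0\}$ let $M(t,m)$ be the unique solution $M$ with the same sign as $m$ of $t^2M^3+t(2-t)M|M|+(1-2t)M-m=0$, let $M(t,0)=0$, and $Z(t,m)=\frac{2M(t,m)}{t|M(t,m)|+1}$, which is the entropy solution of $\partial_tZ+\partial_m\left(m\frac{Z|Z|}{2}-\frac{Z^2}{2}\right)=0$, $Z(0,m)=2m$. Let $U:[0,T]\times\{-1,1\}\times[-1,1]\to\mathbb{R}$ be the corresponding solution of the master equation $$-\partial_tU(t,x,m)+\tfrac12\big[(U(t,-x,m)-U(t,x,m))^-\big]^2-\partial_mU(t,x,m)\big[(1-m)\zeta^+-(1+m)\zeta^-\big]=0,\quad \zeta=U(t,-1,m)-U(t,1,m),$$ $U(T,x,m)=-mx$, i.e. the one with $U(t,-1,m)-U(t,1,m)=Z(T-t,m)$. Explicitly it is constructed by characteristics: for $t\in[0,T]$ and $m\neq0$, put $M=M(T-t,m)$, let $u(\cdot,\pm1)$ solve on $[t,T]$ the system $-\frac{d}{ds}u(s,x)+\frac12\big[(u(s,-x)-u(s,x))^-\big]^2=0$, $u(T,x)=-Mx$, and set $U(t,x,m)=u(t,x)$. Finally $U^*(t,\mu):=U(t,1,2\mu-1)$ for $\mu\in[0,1]$ (values at $\mu=\frac12$ are not involved in the statement). *)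

(* Defs.v *)
From Stdlib Require Import Reals.
From Coquelicot Require Import Coquelicot.
Open Scope R_scope.

Definition neg_part (p : R) : R := Rmax (- p) 0.

Definition H (p : R) : R := (neg_part p) ^ 2 / 2.

Definition S_ (N : nat) (mu : R) : Prop :=
  exists k : nat, (k <= N)%nat /\ mu = INR k / INR N.

(** [is_value T N V]: [V] is the value function V^N of the (N+1)-player game
    with horizon [T].  Only the values [V t mu] with t in [0,T] and mu in S_N
    matter.  As [V] is total, the terms with prefactor N mu at mu = 0 and
    N (1 - mu) at mu = 1 are products with 0, hence 0 whatever [V] is outside
    S_N.  A solution on the closed interval [0,T] is a continuous function
    on [0,T] which satisfies the equation on the open interval; the one-sided
    equations at the end points then follow by continuity. *)
Definition is_value (T : R) (N : nat) (V : R -> R -> R) : Prop :=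
  (forall t mu : R, 0 <= t <= T -> S_ N mu -> -1 <= V t mu <= 1) /\
  (forall mu : R, S_ N mu ->
     continuous_on (fun t => 0 <= t <= T) (fun t => V t mu)) /\
  (forall t mu : R, 0 < t < T -> S_ N mu ->
     ex_derive (fun s => V s mu) t /\
     - Derive (fun s => V s mu) t + H (V t (1 - mu) - V t mu)
     = INR N * mu * neg_part (V t (1 - mu) - V t mu)
         * (V t (mu - 1 / INR N) - V t mu)
       + INR N * (1 - mu)
         * neg_part (V t (mu + 1 / INR N) - V t (1 - mu - 1 / INR N))
         * (V t (mu + 1 / INR N) - V t mu)) /\
  (forall mu : R, S_ N mu -> V T mu = - (2 * mu - 1)).

Inductive state : Set := minus | plus.

Definition flip (x : state) : state :=
  match x with minus => plus | plus => minus end.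

Definition state_val (x : state) : R :=
  match x with minus => -1 | plus => 1 end.

(** [is_M t m M]: [M] is M(t,m), for m <> 0; the first conjunct says that [M]
    has the same sign as [m]. *)
Definition is_M (t m M : R) : Prop :=
  0 < m * M /\
  t ^ 2 * M ^ 3 + t * (2 - t) * (M * Rabs M) + (1 - 2 * t) * M - m = 0.

Definition solves_characteristic (T t M : R) (u : R -> state -> R) : Prop :=
  (forall x : state,
     continuous_on (fun s => t <= s <= T) (fun s => u s x)) /\
  (forall (s : R) (x : state), t < s < T ->
     ex_derive (fun r => u r x) s /\
     - Derive (fun r => u r x) s
       + 1 / 2 * (neg_part (u s (flip x) - u s x)) ^ 2 = 0) /\
  (forall x : state, u T x = - M * state_val x).

(** The solution of the master equation that comes from the entropy solution
    of the scalar conservation law, given by its construction along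
    characteristics.  It is left unconstrained on the shock m = 0. *)
Definition is_entropy_master (T : R) (U : R -> state -> R -> R) : Prop :=
  forall t m : R, 0 <= t <= T -> -1 <= m <= 1 -> m <> 0 ->
    exists (M : R) (u : R -> state -> R),
      is_M (T - t) m M /\ solves_characteristic T t M u /\
      forall x : state, U t x m = u t x.

Definition U_star (U : R -> state -> R -> R) (t mu : R) : R :=
  U t plus (2 * mu - 1).

(* Main.v *)
Require Import Defs.
From Stdlib Require Import Reals Lra Lia List Classical.
From Coquelicot Require Import Coquelicot.
Open Scope R_scope.

(** Read time backwards, s = T - t, and index the states of the game by the
    number j of players in the minority state. Let v_j and w_j be the values of
    a player in the majority and in the minority state, and z_j = w_j - v_j.

    The key fact is that the minority never attracts players: z_j > 0 for
    2j < N, at all times. It is proved together with the monotonicity of v_j in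
    j, because each of the two properties preserves the other
    ([ordered_families_positive], by [positivity_propagates]). With these signs
    the system becomes triangular,

      v_j' = j z_(j-1) (v_(j-1) - v_j),
      w_j' = - z_j^2 / 2 + j z_j (w_(j-1) - w_j),

    ([major_derive_triangular], [minor_derive_triangular]), so that the values
    at a distance eps from one half only depend on states that are even further
    away from it. The discontinuity of the limit is never seen.

    On the side of the limit, the characteristics are explicit
    ([characteristic_explicit]): at a mean m > 0 the two values are - M and
    - M + 2M / (1 + s M), where M > 0 solves (1 - M)(1 + s M)^2 = 1 - m. The
    divided differences of this equation in M are bounded below by m
    ([slope_ge]). Hence, for m >= eta > 0, M is differentiable in s, and it
    satisfies the discrete system above up to an error O(1/N), with a constant
    that depends on eta and T only ([consistency_majority],
    [consistency_minority]).

    Both systems start from the same values. Their difference satisfies a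
    linear transport inequality with nonnegative speeds of order N, which do
    not enter the maximum-norm estimate of [transport_gronwall]; this gives the
    bound C / N ([values_close_to_limits]). Games with N < 1 / eps are covered
    by the trivial bound 2 on the difference. *)

(** * Reversed time, and propagation of positivity along differential inequalities *)

(** Freezing the function outside the interval makes it continuous on all of R,
    which is the form in which the mean value theorem and the algebra of
    continuous functions are easiest to apply. *)
Definition reversed (a b : R) (f : R -> R) (s : R) : R :=
  f (b - Rmax 0 (Rmin (b - a) s)).

Lemma clamp_bounds (L s : R) : 0 <= L -> 0 <= Rmax 0 (Rmin L s) <= L.
Proof.
  intros HL; unfold Rmax, Rmin; repeat destruct (Rle_dec _ _); lra.
Qed.

Lemma clamp_id (L s : R) : 0 <= s <= L -> Rmax 0 (Rmin L s) = s.
Proof.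
  intros HL; unfold Rmax, Rmin; repeat destruct (Rle_dec _ _); lra.
Qed.

Lemma clamp_lipschitz (L s r : R) :
  Rabs (Rmax 0 (Rmin L r) - Rmax 0 (Rmin L s)) <= Rabs (r - s).
Proof.
  unfold Rmax, Rmin; repeat destruct (Rle_dec _ _); unfold Rabs;
    repeat destruct (Rcase_abs _); lra.
Qed.

Lemma reversed_eq (a b : R) (f : R -> R) (s : R) :
  0 <= s <= b - a -> reversed a b f s = f (b - s).
Proof. intros Hs; unfold reversed; rewrite clamp_id; auto. Qed.

Lemma reversed_continuous (a b : R) (f : R -> R) :
  a <= b -> continuous_on (fun t => a <= t <= b) f ->
  forall s, continuous (reversed a b f) s.
Proof.
  intros Hab Hf s.
  assert (Hc : a <= b - Rmax 0 (Rmin (b - a) s) <= b)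
    by (pose proof (clamp_bounds (b - a) s); lra).
  specialize (Hf _ Hc).
  unfold continuous, reversed.
  intros P HP; specialize (Hf P HP).
  destruct Hf as [d Hd].
  exists d; intros r Hr; apply Hd.
  - assert (E := clamp_lipschitz (b - a) s r).
    unfold ball in Hr |- *; simpl in Hr |- *.
    unfold AbsRing_ball, abs, minus, plus, opp in Hr |- *; simpl in Hr |- *.
    replace (b - Rmax 0 (Rmin (b - a) r) + - (b - Rmax 0 (Rmin (b - a) s)))
      with (- (Rmax 0 (Rmin (b - a) r) - Rmax 0 (Rmin (b - a) s))) by ring.
    rewrite Rabs_Ropp; unfold Rminus in E |- *; lra.
  - pose proof (clamp_bounds (b - a) r); lra.
Qed.

Lemma locally_between (a b s : R) (P : R -> Prop) :
  a < s < b -> (forall r, a < r < b -> P r) -> locally s P.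
Proof.
  intros Hs HP.
  assert (Hd : 0 < Rmin (s - a) (b - s)) by (apply Rmin_pos; lra).
  exists (mkposreal _ Hd); intros r Hr.
  unfold ball in Hr; simpl in Hr.
  unfold AbsRing_ball, abs, minus, plus, opp in Hr; simpl in Hr.
  pose proof (Rmin_l (s - a) (b - s)); pose proof (Rmin_r (s - a) (b - s)).
  apply Rabs_def2 in Hr; apply HP; lra.
Qed.

Lemma reversed_derive (a b : R) (f : R -> R) (s : R) :
  0 < s < b - a -> ex_derive f (b - s) ->
  is_derive (reversed a b f) s (- Derive f (b - s)).
Proof.
  intros Hs Hf.
  apply is_derive_ext_loc with (f := fun r => f (b - r)).
  - apply (locally_between 0 (b - a)); auto.
    intros r Hr; rewrite reversed_eq; auto; lra.
  - auto_derive; [exact Hf | unfold Rminus].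
    change (fun x => f x) with f; ring.
Qed.

(** The derivative is only controlled inside the interval, whereas the mean
    value theorem used here may return an end point: truncating the derivative
    at 0 from below gives a function that is nonnegative there as well. *)
Lemma nondecreasing_of_derive (f : R -> R) (a b : R) :
  a <= b -> (forall s, continuous f s) ->
  (forall s, a < s < b -> exists d, is_derive f s d /\ 0 <= d) ->
  f a <= f b.
Proof.
  intros Hab Hc Hd.
  destruct (MVT_gen f a b (fun x => Rmax 0 (Derive f x))) as [c [_ Hc2]].
  - rewrite Rmin_left, Rmax_right by lra; intros x Hx.
    destruct (Hd x Hx) as [d [D1 D2]].
    rewrite (is_derive_unique _ _ _ D1), Rmax_right by lra; auto.
  - intros x _; apply continuity_pt_filterlim, Hc.
  - pose proof (Rmax_l 0 (Derive f c)); nra.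
Qed.

Lemma constant_of_derive (f : R -> R) (a b : R) :
  a <= b -> (forall s, continuous f s) ->
  (forall s, a < s < b -> is_derive f s 0) -> f a = f b.
Proof.
  intros Hab Hc Hd; apply Rle_antisym.
  - apply nondecreasing_of_derive; auto.
    intros s Hs; exists 0; split; [auto | lra].
  - apply Ropp_le_cancel.
    apply (nondecreasing_of_derive (fun x => - f x)); auto.
    + intros s; apply (continuous_opp f); auto.
    + intros s Hs; exists 0; split; [| lra].
      replace 0 with (- 0) by ring.
      apply (is_derive_opp f); auto.
Qed.

Lemma exp_growth_of_derive (f : R -> R) (C a b : R) :
  a <= b -> (forall s, continuous f s) ->
  (forall s, a < s < b -> exists d, is_derive f s d /\ - C * f s <= d) ->
  exp (C * a) * f a <= exp (C * b) * f b.
Proof.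
  intros Hab Hc Hd.
  apply (nondecreasing_of_derive (fun s => exp (C * s) * f s)); auto.
  - intros s; apply (continuous_mult (fun s => exp (C * s)) f); auto.
    apply (ex_derive_continuous (V := R_NormedModule)); auto_derive; auto.
  - intros s Hs; destruct (Hd s Hs) as [d [D1 D2]].
    exists (exp (C * s) * (C * f s + d)); split.
    + auto_derive; [exists d; auto |].
      replace (Derive (fun x : R => f x) s) with d
        by (symmetry; apply (is_derive_unique f s d D1)).
      ring.
    + pose proof (exp_pos (C * s)); apply Rmult_le_pos; lra.
Qed.

Lemma positive_near (I : Type) (P : I -> Prop) (f : I -> R -> R) (s : R)
  (l : list I) :
  (forall i, P i -> continuous (f i) s) -> (forall i, P i -> 0 < f i s) ->
  locally s (fun r => forall i, In i l -> P i -> 0 < f i r).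
Proof.
  intros Hc Hp; induction l as [|i l IH].
  - apply filter_forall; intros r i [].
  - destruct (classic (P i)) as [Pi|Pi].
    + assert (HI : locally s (fun r => 0 < f i r)).
      { apply (Hc i Pi (fun y => 0 < y)).
        apply (open_gt 0); auto. }
    
      generalize (filter_and _ _ HI IH); apply filter_imp.
      intros r [H1 H2] k [<-|Hk] Pk; auto.
    + revert IH; apply filter_imp; intros r H1 k [<-|Hk] Pk; auto.
      contradiction.
Qed.

(** Continuous induction. As long as the whole family is positive, the
    differential inequality keeps each [f i] above [exp (- C s) * f i 0], so
    none of them can be the first to reach 0. The constant [C] only has to
    exist, which is why the estimates for the game may use constants that grow
    with N. *)
Lemma positivity_propagates (I : Type) (l : list I) (P : I -> Prop)
  (f : I -> R -> R) (C T : R) :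
  (forall i, P i -> In i l) ->
  (forall i s, P i -> continuous (f i) s) ->
  (forall i, P i -> 0 < f i 0) ->
  (forall i s, P i -> 0 < s < T -> (forall k, P k -> 0 < f k s) ->
     exists d, is_derive (f i) s d /\ - C * f i s <= d) ->
  forall i s, P i -> 0 <= s <= T -> 0 < f i s.
Proof.
  intros Hl Hc H0 Hd.
  assert (Hstep : forall s, 0 <= s <= T ->
    (forall r, 0 <= r < s -> forall k, P k -> 0 < f k r) ->
    forall k, P k -> 0 < f k s).
  { intros s Hs Hb k Pk.
    assert (E : exp (C * 0) * f k 0 <= exp (C * s) * f k s).
    { apply exp_growth_of_derive; auto; try lra.
      intros r Hr; apply Hd; auto; try lra.
      intros i Pi; apply Hb; auto; lra. }
    rewrite Rmult_0_r, exp_0 in E.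
    pose proof (exp_pos (C * s)); pose proof (H0 k Pk); nra. }
  intros i s Pi Hs.
  set (E := fun x => 0 <= x <= s /\
              forall r, 0 <= r < x -> forall k, P k -> 0 < f k r).
  destruct (completeness E) as [t [Ht1 Ht2]].
  { exists s; intros x [Hx _]; lra. }
  { exists 0; split; [lra |]; intros; lra. }
  assert (E0 : E 0) by (split; [lra |]; intros; lra).
  assert (Ht0 : 0 <= t) by (apply Ht1; auto).
  assert (Hts : t <= s) by (apply Ht2; intros x [Hx _]; lra).
  assert (Hb : forall r, 0 <= r < t -> forall k, P k -> 0 < f k r).
  { intros r Hr k Pk.
    destruct (classic (exists x, E x /\ r < x)) as [[x [[_ Hx] Hrx]]|Hn].
    - apply (Hx r); auto; lra.
    - exfalso; apply (Rlt_not_le t r); [lra |].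
      apply Ht2; intros x Hx; apply Rnot_lt_le; intros Hrx.
      apply Hn; exists x; auto. }
  assert (Hat : forall k, P k -> 0 < f k t) by (apply Hstep; auto; lra).
  destruct (Rle_lt_dec s t) as [Hst|Hst].
  { replace s with t by lra; auto. }
  exfalso.
  destruct (positive_near I P f t l) as [d Hnear]; auto.
  assert (Hd2 := cond_pos d).
  set (x := Rmin s (t + d / 2)).
  assert (Hx1 : x <= s) by apply Rmin_l.
  assert (Hx2 : x <= t + d / 2) by apply Rmin_r.
  assert (Hx3 : t < x) by (apply Rmin_glb_lt; lra).
  apply (Rlt_not_le x t); auto.
  apply Ht1; split; [lra |].
  intros r Hr k Pk.
  destruct (Rlt_le_dec r t) as [Hrt|Hrt]; [apply Hb; auto; lra |].
  apply (Hnear r); auto.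
  unfold ball; simpl; unfold AbsRing_ball, abs, minus, plus, opp; simpl.
  rewrite Rabs_right; lra.
Qed.

(** Gronwall's inequality in the maximum norm for a discrete transport
    equation. The transport term [a * (y (p i) - y i)] pulls [y i] towards
    another member of the family, hence does not push the largest one upwards,
    and the bound does not depend on the size [A] of the speeds. It follows
    from the propagation of positivity, applied to the distances between
    [y i], [- y i] and the barrier [2 r exp ((L + 1) s)]; the barrier grows
    strictly faster than [L * barrier + r]. *)
Lemma transport_gronwall (I : Type) (l : list I) (P : I -> Prop) (p : I -> I)
  (y : I -> R -> R) (A L r T : R) :
  0 <= L -> 0 < r ->
  (forall i, P i -> In i l) -> (forall i, P i -> P (p i)) ->
  (forall i s, P i -> continuous (y i) s) ->
  (forall i, P i -> y i 0 = 0) ->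
  (forall i s b, P i -> 0 < s < T -> (forall k, P k -> Rabs (y k s) <= b) ->
     exists a d, 0 <= a <= A /\ is_derive (y i) s d /\
       Rabs (d - a * (y (p i) s - y i s)) <= L * b + r) ->
  forall i s, P i -> 0 <= s <= T -> Rabs (y i s) <= 2 * r * exp ((L + 1) * s).
Proof.
  intros HL Hr Hl Hp Hc H0 Hd i s Pi Hs.
  set (b := fun s => 2 * r * exp ((L + 1) * s)).
  set (sg := fun e : bool => if e then 1 else -1).
  set (f := fun (ie : I * bool) s => b s - sg (snd ie) * y (fst ie) s).
  assert (Hpos : forall ie s, P (fst ie) -> 0 <= s <= T -> 0 < f ie s).
  { intros ie s' Pie Hs'.
    apply (positivity_propagates (I * bool) (list_prod l (true :: false :: nil))
             (fun ie => P (fst ie)) f A T); auto.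
    - intros [k e] Pk; apply in_prod; [apply Hl; auto |].
      destruct e; simpl; auto.
    - intros [k e] u Pk; unfold f.
      apply (continuous_minus (V := R_NormedModule)).
      + apply (ex_derive_continuous (V := R_NormedModule)); unfold b; auto_derive; auto.
      + apply (continuous_scal_r (sg (snd (k, e))) (fun s => y (fst (k, e)) s)).
        apply Hc; auto.
    - intros [k e] Pk; unfold f, b; rewrite H0 by auto.
      rewrite Rmult_0_r, exp_0; lra.
    - intros [k e] u Pk Hu Hall; simpl in Pk.
      assert (Habs : forall k, P k -> Rabs (y k u) <= b u).
      { intros j Pj; apply Rabs_le.
        pose proof (Hall (j, true) Pj) as H1; pose proof (Hall (j, false) Pj) as H2.
        unfold f, sg in H1, H2; simpl in H1, H2; lra. }
      destruct (Hd k u (b u) Pk Hu Habs) as [a [d [Ha [Hdv Hbd]]]].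
      exists ((L + 1) * b u - sg e * d); split.
      + unfold f, b; simpl.
        auto_derive; [exists d; exact Hdv |].
        replace (Derive (fun x : R => y k x) u) with d
          by (symmetry; apply (is_derive_unique (y k) u d Hdv)).
        ring.
      + assert (Hpk := Hall (k, e) Pk).
        assert (Hbr : r <= b u).
        { unfold b.
          assert (E : exp 0 < exp ((L + 1) * u))
            by (apply exp_increasing, Rmult_lt_0_compat; lra).
          rewrite exp_0 in E; nra. }
        assert (Hnext := Hall (p k, e) (Hp k Pk)).
        unfold f in Hpk, Hnext |- *; simpl in Hpk, Hnext |- *.
        apply Rabs_le_between in Hbd.
        destruct e; unfold sg in Hpk, Hnext |- *; nra. }
  apply Rabs_le.
  pose proof (Hpos (i, true) s Pi Hs) as H1; pose proof (Hpos (i, false) s Pi Hs) as H2.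
  unfold f, sg in H1, H2; simpl in H1, H2; unfold b in H1, H2; lra.
Qed.

(** Caratheodory's criterion; it turns exact divided differences into
    derivatives without error terms. *)
Lemma is_derive_caratheodory (f phi : R -> R) (x : R) :
  locally x (fun y => f y - f x = phi y * (y - x)) -> continuous phi x ->
  is_derive f x (phi x).
Proof.
  intros [d1 Hf] Hphi.
  apply is_derive_Reals; intros e He.
  destruct (Hphi (ball (phi x) (mkposreal e He)) (locally_ball _ _)) as [d2 Hd2].
  assert (Hd : 0 < Rmin d1 d2) by (apply Rmin_pos; apply cond_pos).
  exists (mkposreal _ Hd); intros h Hh0 Hh; simpl in Hh.
  pose proof (Rmin_l d1 d2); pose proof (Rmin_r d1 d2).
  assert (Hb : forall d : posreal, Rabs h < d -> ball x d (x + h)).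
  { intros d Hhd; unfold ball; simpl; unfold AbsRing_ball, abs, minus, plus, opp; simpl.
    replace (x + h + - x) with h by ring; auto. }
  rewrite Hf by (apply Hb; lra).
  assert (E := Hd2 (x + h) (Hb d2 ltac:(lra))).
  unfold ball in E; simpl in E; unfold AbsRing_ball, abs, minus, plus, opp in E; simpl in E.
  replace (phi (x + h) * (x + h - x) / h - phi x) with (phi (x + h) + - phi x)
    by (field; auto).
  auto.
Qed.

Lemma lipschitz_continuous_on (D : R -> Prop) (f : R -> R) (K : R) :
  (forall x y, D x -> D y -> Rabs (f y - f x) <= K * Rabs (y - x)) ->
  continuous_on D f.
Proof.
  intros HK x Dx Q [e He].
  assert (Hd : 0 < e / (Rabs K + 1)).
  { apply Rdiv_lt_0_compat; [apply cond_pos | pose proof (Rabs_pos K); lra]. }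
  exists (mkposreal _ Hd); intros y Hy Dy; apply He.
  unfold ball in Hy |- *; simpl in Hy |- *.
  unfold AbsRing_ball, abs, minus, plus, opp in Hy |- *; simpl in Hy |- *.
  eapply Rle_lt_trans; [apply (HK x y Dx Dy) |].
  apply (Rmult_lt_compat_l (Rabs K + 1)) in Hy; [| pose proof (Rabs_pos K); lra].
  replace ((Rabs K + 1) * (e / (Rabs K + 1))) with (pos e) in Hy
    by (field; pose proof (Rabs_pos K); lra).
  pose proof (Rle_abs K); pose proof (Rabs_pos (y - x)); unfold Rminus in *; nra.
Qed.

(** * The characteristic system in closed form *)

Lemma neg_part_of_nonneg (p : R) : 0 <= p -> neg_part p = 0.
Proof. intros Hp; apply Rmax_right; lra. Qed.

Lemma neg_part_of_nonpos (p : R) : p <= 0 -> neg_part p = - p.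
Proof. intros Hp; apply Rmax_left; lra. Qed.

(** For M > 0 the difference z of the two components starts at 2M in reversed
    time and satisfies z' = - z |z| / 2, so it stays positive. The plus
    component is then constant and z is 2M / (1 + s M). *)
Lemma characteristic_explicit (T t M : R) (u : R -> state -> R) :
  t <= T -> 0 < M -> solves_characteristic T t M u ->
  u t Defs.plus = - M /\
  u t Defs.minus = - M + 2 * M / (1 + (T - t) * M).
Proof.
  intros Ht HM [Hc [Hode HT]].
  set (p := reversed t T (fun s => u s Defs.plus)).
  set (q := reversed t T (fun s => u s Defs.minus)).
  assert (Cp : forall s, continuous p s)
    by (apply (reversed_continuous t T (fun s => u s Defs.plus)); auto).
  assert (Cq : forall s, continuous q s)
    by (apply (reversed_continuous t T (fun s => u s Defs.minus)); auto).
  assert (p0 : p 0 = - M).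
  { unfold p; rewrite reversed_eq, Rminus_0_r, HT by lra; simpl; ring. }
  assert (q0 : q 0 = M).
  { unfold q; rewrite reversed_eq, Rminus_0_r, HT by lra; simpl; ring. }
  assert (Dp : forall s, 0 < s < T - t ->
    is_derive p s (- (1 / 2 * neg_part (q s - p s) ^ 2))).
  { intros s Hs.
    destruct (Hode (T - s) Defs.plus) as [E1 E2]; [lra |].
    assert (E := reversed_derive t T (fun s => u s Defs.plus) s Hs E1).
    unfold q, p; rewrite !reversed_eq by lra; simpl in E2.
    replace (- (1 / 2 * neg_part (u (T - s) Defs.minus - u (T - s) Defs.plus) ^ 2))
      with (- Derive (fun s => u s Defs.plus) (T - s)) by (simpl; lra).
    exact E. }
  assert (Dq : forall s, 0 < s < T - t ->
    is_derive q s (- (1 / 2 * neg_part (p s - q s) ^ 2))).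
  { intros s Hs.
    destruct (Hode (T - s) Defs.minus) as [E1 E2]; [lra |].
    assert (E := reversed_derive t T (fun s => u s Defs.minus) s Hs E1).
    unfold q, p; rewrite !reversed_eq by lra; simpl in E2.
    replace (- (1 / 2 * neg_part (u (T - s) Defs.plus - u (T - s) Defs.minus) ^ 2))
      with (- Derive (fun s => u s Defs.minus) (T - s)) by (simpl; lra).
    exact E. }
  assert (Cz : forall s, continuous (fun s => q s - p s) s).
  { intros s; apply (continuous_minus q p); auto. }
  assert (Dz : forall s, 0 < s < T - t -> 0 < q s - p s ->
    is_derive (fun s => q s - p s) s (- (q s - p s) ^ 2 / 2)).
  { intros s Hs Hz.
    replace (- (q s - p s) ^ 2 / 2) with
      (- (1 / 2 * neg_part (p s - q s) ^ 2) - - (1 / 2 * neg_part (q s - p s) ^ 2)).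
    - apply (is_derive_minus q p); auto.
    - rewrite (neg_part_of_nonneg (q s - p s)), (neg_part_of_nonpos (p s - q s)) by lra.
      field. }
  assert (Hz : forall s, 0 <= s <= T - t -> 0 < q s - p s).
  { intros s Hs.
    (* the second member only keeps z bounded, so that - z^2 / 2 >= - C z *)
    apply (positivity_propagates bool (true :: false :: nil) (fun _ => True)
      (fun b s => if b then q s - p s else 2 * M + 1 - (q s - p s))
      (M + 1) (T - t)) with (i := true); auto.
    - intros []; simpl; auto.
    - intros [] r _; [apply Cz |].
      apply (continuous_minus (fun _ => 2 * M + 1) (fun s => q s - p s)); auto.
      apply continuous_const.
    - intros [] _; rewrite p0, q0; lra.
    - intros b r _ Hr Hall.
      pose proof (Hall true I) as H1; pose proof (Hall false I) as H2; simpl in H1, H2.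
      destruct b.
      + eexists; split; [apply Dz; auto | nra].
      + exists (0 - (- (q r - p r) ^ 2 / 2)); split; [| nra].
        apply (is_derive_minus (fun _ => 2 * M + 1) (fun s => q s - p s)); auto.
        apply (is_derive_const (2 * M + 1) r). }
  assert (Ep : p 0 = p (T - t)).
  { apply constant_of_derive; auto; try lra.
    intros s Hs; replace 0 with (- (1 / 2 * neg_part (q s - p s) ^ 2)); auto.
    rewrite neg_part_of_nonneg; [ring |].
    apply Rlt_le, Hz; lra. }
  (* g measures the defect in the explicit formula; it satisfies the linear
     equation g' = - z g / 2, hence g^2 cannot grow from g(0) = 0 *)
  set (z := fun s => q s - p s).
  set (g := fun s => (q s - p s) * (1 + s * M) - 2 * M).
  assert (Cg : forall s, continuous (fun s => - (g s * g s)) s).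
  { assert (C1 : forall s, continuous g s).
    { intros s; apply (continuous_minus (fun s => (q s - p s) * (1 + s * M)) (fun _ => 2 * M)).
      - apply (continuous_mult (fun s => q s - p s) (fun s => 1 + s * M)); auto.
        apply (ex_derive_continuous (V := R_NormedModule)); auto_derive; auto.
      - apply continuous_const. }
    intros s; apply (continuous_opp (fun s => g s * g s)), (continuous_mult g g); auto. }
  assert (Eg : - (g 0 * g 0) <= - (g (T - t) * g (T - t))).
  { apply (nondecreasing_of_derive (fun s => - (g s * g s))); auto; try lra.
    intros s Hs.
    assert (Hzs := Hz s ltac:(lra)).
    assert (Ds := Dz s Hs Hzs).
    exists ((q s - p s) * (g s * g s)); split.
    - change (is_derive (fun s => - ((z s * (1 + s * M) - 2 * M)
        * (z s * (1 + s * M) - 2 * M))) s (z s * (g s * g s))).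
      auto_derive; [repeat split; eexists; exact Ds |].
      replace (Derive (fun x : R => z x) s) with (- (q s - p s) ^ 2 / 2)
        by (symmetry; apply (is_derive_unique z s _ Ds)).
      unfold g; change (z s) with (q s - p s); field.
    - apply Rmult_le_pos; nra. }
  assert (G0 : g 0 = 0) by (unfold g; rewrite p0, q0; ring).
  assert (GT : g (T - t) = 0) by nra.
  assert (Epq : p (T - t) = u t Defs.plus /\ q (T - t) = u t Defs.minus).
  { unfold p, q; rewrite !reversed_eq by lra.
    replace (T - (T - t)) with t by ring; auto. }
  destruct Epq as [Ep' Eq']; rewrite <- Ep', <- Eq', <- Ep, p0; split; auto.
  unfold g in GT; rewrite <- Ep, p0 in GT.
  assert (0 < 1 + (T - t) * M) by nra.
  apply (Rmult_eq_reg_r (1 + (T - t) * M)); [| lra].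
  field_simplify; lra.
Qed.

Lemma solves_characteristic_flip (T t M : R) (u : R -> state -> R) :
  solves_characteristic T t M u ->
  solves_characteristic T t (- M) (fun s x => u s (flip x)).
Proof.
  intros [Hc [Hode HT]]; split; [| split].
  - intros x; apply (Hc (flip x)).
  - intros s x Hs; apply (Hode s (flip x) Hs).
  - intros x; rewrite HT; destruct x; simpl; ring.
Qed.

(** * The terminal mean on a characteristic *)

(** The cubic equation for M, for m > 0, in factored form: along the
    characteristic that ends at the mean M the fraction of players in the
    minority state is multiplied by (1 + s M)^2 in reversed time s. *)
Definition terminal_mean (s m M : R) : Prop := 0 < M /\ (1 - M) * (1 + s * M) ^ 2 = 1 - m.

(** The divided difference in M of the cubic; on the diagonal it is the
    derivative of the cubic. *)
Definition slope (s M1 M2 : R) : R :=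
  s ^ 2 * (M1 ^ 2 + M1 * M2 + M2 ^ 2) + s * (2 - s) * (M1 + M2) + (1 - 2 * s).

Lemma slope_spec (s m1 m2 M1 M2 : R) :
  terminal_mean s m1 M1 -> terminal_mean s m2 M2 -> m2 - m1 = slope s M1 M2 * (M2 - M1).
Proof. intros [_ E1] [_ E2]; unfold slope; lra. Qed.

Lemma terminal_mean_le_1 (s m M : R) : 0 <= s -> m <= 1 -> terminal_mean s m M -> M <= 1.
Proof.
  intros Hs Hm [HM E]; apply Rnot_lt_le; intros H1.
  assert (0 < (1 + s * M) ^ 2) by (apply pow_lt; nra); nra.
Qed.

(** The estimate that makes the region away from the shock m = 0 uniformly
    regular. Write the cubic as M g(M), so that g = m / M >= m at a terminal
    mean. Since m > 0 forces s M > s - 1, the function g is nondecreasing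
    between two terminal means, and the divided difference of M g(M) is at
    least g. Uniqueness, Lipschitz bounds and differentiability of M all come
    from this. *)
Lemma slope_ge (s m1 m2 M1 M2 : R) :
  0 <= s -> 0 < m1 -> m1 <= 1 -> 0 < m2 -> terminal_mean s m1 M1 -> terminal_mean s m2 M2 ->
  m1 <= slope s M1 M2.
Proof.
  intros Hs H1 H1' H2 R1 R2.
  assert (L1 := terminal_mean_le_1 s m1 M1 Hs H1' R1).
  destruct R1 as [P1 E1], R2 as [P2 E2].
  (* the right-hand side is g(M1) = m1 / M1 *)
  assert (G : m1 <= s ^ 2 * M1 ^ 2 + s * (2 - s) * M1 + (1 - 2 * s)).
  { apply (Rmult_le_reg_l M1); auto; nra. }
  assert (K : s - 1 < s * M1).
  { apply Rnot_le_lt; intros Hle.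
    assert (0 < (s * M1 + 1) ^ 2 - s * (s * M1 + 2)) by nra.
    nra. }
  assert (0 <= M2 * (s * (s * (M1 + M2) + 2 - s))).
  { apply Rmult_le_pos; [lra |]; apply Rmult_le_pos; nra. }
  unfold slope; nra.
Qed.

Lemma terminal_mean_unique (s m M1 M2 : R) :
  0 <= s -> 0 < m -> m <= 1 -> terminal_mean s m M1 -> terminal_mean s m M2 -> M1 = M2.
Proof.
  intros Hs H0 H1 R1 R2.
  assert (E := slope_spec s m m M1 M2 R1 R2).
  assert (G := slope_ge s m m M1 M2 Hs H0 H1 H0 R1 R2).
  nra.
Qed.

Lemma is_M_terminal_mean (s m M : R) : 0 < m -> is_M s m M -> terminal_mean s m M.
Proof.
  intros Hm [H1 H2].
  assert (0 < M) by nra; split; auto.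
  rewrite Rabs_right in H2 by lra; lra.
Qed.

Lemma is_M_opp (s m M : R) : is_M s m M -> is_M s (- m) (- M).
Proof.
  intros [H1 H2]; split; [nra |].
  rewrite Rabs_Ropp; lra.
Qed.

(** Negative means reduce to positive ones by exchanging the two states, and
    uniqueness of M identifies the two terminal means. *)
Lemma entropy_master_explicit (T : R) (U : R -> state -> R -> R) (s m : R) :
  is_entropy_master T U -> 0 <= s <= T -> 0 < m <= 1 ->
  exists M, terminal_mean s m M /\
    U (T - s) Defs.plus m = - M /\
    U (T - s) Defs.plus (- m) = - M + 2 * M / (1 + s * M).
Proof.
  intros hU Hs Hm.
  destruct (hU (T - s) m) as [M [u [HM [Hu EU]]]]; try lra.
  destruct (hU (T - s) (- m)) as [M' [u' [HM' [Hu' EU']]]]; try lra.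
  replace (T - (T - s)) with s in HM, HM' by ring.
  apply is_M_opp in HM'; rewrite Ropp_involutive in HM'.
  apply is_M_terminal_mean in HM; try lra; apply is_M_terminal_mean in HM'; try lra.
  assert (E : M = - M') by (apply (terminal_mean_unique s m); auto; lra).
  apply solves_characteristic_flip in Hu'; rewrite <- E in Hu'.
  assert (HM0 : 0 < M) by apply HM.
  apply characteristic_explicit in Hu; auto; try lra.
  apply characteristic_explicit in Hu'; auto; try lra.
  replace (T - (T - s)) with s in Hu' by ring; simpl in Hu'.
  exists M; rewrite EU, EU'; intuition.
Qed.

(** Regard [M'] as a terminal mean at the time [s] for another initial mean
    m', which differs from m by at most a constant times |s' - s|. If m' is positive the
    slope bound applies; otherwise |m' - m| >= m already exceeds m |M' - M|. *)
Lemma terminal_mean_lipschitz_time (T s s' m M M' : R) :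
  0 <= s <= T -> 0 <= s' <= T -> 0 < m <= 1 -> terminal_mean s m M -> terminal_mean s' m M' ->
  Rabs (M' - M) <= (2 + 2 * T) / m * Rabs (s' - s).
Proof.
  intros Hs Hs' Hm R1 R2.
  assert (L1 : M <= 1) by (apply (terminal_mean_le_1 s m); auto; lra).
  assert (L2 : M' <= 1) by (apply (terminal_mean_le_1 s' m); auto; lra).
  (* the initial mean for which M' would be the terminal mean at time s *)
  set (m' := 1 - (1 - M') * (1 + s * M') ^ 2).
  assert (R3 : terminal_mean s m' M') by (split; [apply R2 | unfold m'; ring]).
  assert (E := slope_spec s m m' M M' R1 R3).
  assert (D : Rabs (m' - m) <= (2 + 2 * T) * Rabs (s' - s)).
  { destruct R2 as [P2 E2].
    assert (Em : m' - m = (1 - M') * M' * (2 + M' * (s + s')) * (s' - s)) by (unfold m'; lra).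
    assert (B1 : 0 <= (1 - M') * M') by nra.
    assert (B2 : (1 - M') * M' <= 1) by nra.
    assert (B3 : 0 <= 2 + M' * (s + s')) by nra.
    assert (B4 : 2 + M' * (s + s') <= 2 + 2 * T) by nra.
    rewrite Em, Rabs_mult, (Rabs_right ((1 - M') * M' * _)) by nra.
    apply Rmult_le_compat_r; [apply Rabs_pos | nra]. }
  assert (F : m * Rabs (M' - M) <= Rabs (m' - m)).
  { destruct (Rle_lt_dec m' 0) as [Hn|Hp].
    - assert (Rabs (M' - M) <= 1)
        by (apply Rabs_le; destruct R1, R2; lra).
      rewrite (Rabs_left1 (m' - m)) by lra; nra.
    - assert (G := slope_ge s m m' M M' (proj1 Hs) (proj1 Hm) (proj2 Hm) Hp R1 R3).
      rewrite E, Rabs_mult, (Rabs_right (slope _ _ _)) by lra.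
      apply Rmult_le_compat_r; [apply Rabs_pos | auto]. }
  apply (Rmult_le_reg_l m); [lra |].
  replace (m * ((2 + 2 * T) / m * Rabs (s' - s))) with ((2 + 2 * T) * Rabs (s' - s))
    by (field; lra).
  lra.
Qed.

(** Implicit differentiation: subtracting the two cubic equations gives
    A(r) (M r - M s) = B(r) (r - s) with A and B continuous, so that B / A is
    the function required by Caratheodory's criterion. The value of the
    derivative is the transport equation for M with speed (1 - m) z, as
    1 / slope is the derivative of M in m. *)
Lemma terminal_mean_derive_time (T s m : R) (M : R -> R) :
  0 < s < T -> 0 < m <= 1 -> (forall r, 0 <= r <= T -> terminal_mean r m (M r)) ->
  is_derive M s ((1 - m) * (2 * M s / (1 + s * M s)) / slope s (M s) (M s)).
Proof.
  intros Hs Hm HM.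
  assert (Cont : continuous_on (fun r => 0 <= r <= T) M).
  { apply lipschitz_continuous_on with (K := (2 + 2 * T) / m).
    intros r r' Hr Hr'; apply (terminal_mean_lipschitz_time T r r' m); auto. }
  assert (CM : continuous M s).
  { apply (continuous_continuous_on (fun r => 0 <= r <= T) M s); auto.
    apply (locally_between 0 T s); auto; intros r Hr; lra. }
  set (A := fun r => slope s (M s) (M r)).
  set (B := fun r => (1 - M r) * M r * (2 + M r * (s + r))).
  assert (CA : continuous A s).
  { apply (continuous_comp M (slope s (M s))); auto.
    apply (ex_derive_continuous (V := R_NormedModule)); unfold slope; auto_derive; auto. }
  assert (CB : continuous B s).
  { unfold B.
    apply (continuous_mult (fun r => (1 - M r) * M r) (fun r => 2 + M r * (s + r))).
    - apply (continuous_comp M (fun x => (1 - x) * x)); auto.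
      apply (ex_derive_continuous (V := R_NormedModule)); auto_derive; auto.
    - apply (continuous_plus (fun _ => 2) (fun r => M r * (s + r))).
      + apply continuous_const.
      + apply (continuous_mult M (fun r => s + r)); auto.
        apply (ex_derive_continuous (V := R_NormedModule)); auto_derive; auto. }
  assert (Rs := HM s ltac:(lra)).
  assert (HA : 0 < A s).
  { apply Rlt_le_trans with m; [lra |].
    apply (slope_ge s m m); auto; lra. }
  replace ((1 - m) * (2 * M s / (1 + s * M s)) / slope s (M s) (M s)) with (B s * / A s).
  2:{ unfold A in *; destruct Rs as [P E]; unfold B; rewrite <- E; field.
      assert (0 < s * M s) by (apply Rmult_lt_0_compat; lra).
      split; lra. }
  apply (is_derive_caratheodory M (fun r => B r * / A r)).
  - assert (LA : locally s (fun r => 0 < A r)).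
    { apply (CA (fun y => 0 < y)), (open_gt 0); auto. }
    assert (LI : locally s (fun r => 0 < r < T)) by (apply (locally_between 0 T s); auto).
    generalize (filter_and _ _ LA LI); apply filter_imp.
    intros r [HAr Hr].
    destruct (HM r ltac:(lra)) as [P' E'], Rs as [P E].
    apply (Rmult_eq_reg_l (A r)); [| lra].
    replace (A r * (B r * / A r * (r - s))) with (B r * (r - s)) by (field; lra).
    unfold A, B, slope; lra.
  - apply (continuous_mult B (fun r => / A r)); auto.
    apply continuous_Rinv_comp; auto; lra.
Qed.

(** * Consistency of the limit with the finite-difference system *)

(** The value Z of the entropy solution on the characteristic with terminal
    mean M: the cost of being in the minority state. *)
Definition jump (s M : R) : R := 2 * M / (1 + s * M).

Lemma inv_1_plus_bounds (a : R) : 0 <= a -> 0 < / (1 + a) <= 1.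
Proof.
  intros Ha; split; [apply Rinv_0_lt_compat; lra |].
  rewrite <- Rinv_1; apply Rinv_le_contravar; lra.
Qed.

(** The factor c is the product of the reciprocals of 1 + s M and 1 + s M';
    the last bound compares it with half the derivative of the jump in M. *)
Lemma jump_diff (s M M' : R) : 0 <= s -> 0 <= M -> 0 <= M' ->
  exists c, 0 <= c <= 1 /\ jump s M' - jump s M = 2 * c * (M' - M) /\
    Rabs (c - (/ (1 + s * M)) ^ 2) <= s * Rabs (M' - M).
Proof.
  intros Hs HM HM'.
  assert (P : 0 <= s * M) by nra; assert (P' : 0 <= s * M') by nra.
  set (a := / (1 + s * M)); set (a' := / (1 + s * M')).
  assert (Ha : 0 < a <= 1) by (apply inv_1_plus_bounds; auto).
  assert (Ha' : 0 < a' <= 1) by (apply inv_1_plus_bounds; auto).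
  exists (a * a'); split; [nra | split].
  - unfold jump, a, a'; field; lra.
  - replace (a * a' - a ^ 2) with (- (s * (a * a * a') * (M' - M)))
      by (unfold a, a'; field; lra).
    rewrite Rabs_Ropp, !Rabs_mult, (Rabs_right s), (Rabs_right a), (Rabs_right a') by lra.
    apply Rmult_le_compat_r; [apply Rabs_pos |].
    assert (a * a <= 1) by nra; assert (a * a * a' <= 1) by nra; nra.
Qed.

Lemma jump_bounds (s M : R) : 0 <= s -> 0 <= M <= 1 -> 0 <= jump s M <= 2.
Proof.
  intros Hs HM; destruct (jump_diff s 0 M) as [c [Hc [E _]]]; try lra.
  replace (jump s 0) with 0 in E by (unfold jump; field; lra); nra.
Qed.

(** First-order Taylor expansion in m with an explicit remainder, obtained
    from the exact relation h = slope * (M' - M) instead of second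
    derivatives. *)
Lemma terminal_mean_space_expansion (T s m h eta M M' : R) :
  0 <= s <= T -> 0 < eta <= m -> 0 <= h -> m + h <= 1 ->
  terminal_mean s m M -> terminal_mean s (m + h) M' ->
  0 <= M' - M <= h / eta /\
  Rabs (M' - M - h / slope s M M) <= (4 * T ^ 2 + 2 * T) * (h ^ 2 / eta ^ 3).
Proof.
  intros Hs Heta Hh Hm R1 R2.
  assert (L1 : M <= 1) by (apply (terminal_mean_le_1 s m); auto; lra).
  assert (L2 : M' <= 1) by (apply (terminal_mean_le_1 s (m + h)); auto; lra).
  assert (G1 : m <= slope s M M) by (apply (slope_ge s m m); auto; lra).
  assert (G2 : m <= slope s M M') by (apply (slope_ge s m (m + h)); auto; lra).
  assert (E := slope_spec s m (m + h) M M' R1 R2).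
  destruct R1 as [P1 _], R2 as [P2 _].
  set (d := M' - M) in *; set (A := slope s M M) in *.
  assert (Hd : 0 <= d) by nra.
  assert (Hd2 : d <= h / eta).
  { apply (Rmult_le_reg_l eta); [lra |].
    replace (eta * (h / eta)) with h by (field; lra); nra. }
  split; [auto |].
  (* slope s M M' = A + d * q *)
  set (q := s ^ 2 * (M' + 2 * M) + s * (2 - s)).
  assert (Eq : h = (A + d * q) * d) by (unfold q, A, d, slope in *; lra).
  assert (Hq : Rabs q <= 4 * T ^ 2 + 2 * T).
  { assert (s ^ 2 <= T ^ 2) by nra.
    assert (0 <= s ^ 2) by nra.
    apply Rabs_le; unfold q; split; nra. }
  assert (HA : 0 < A) by lra.
  replace (d - h / A) with (- (q * (d * d / A))) by (rewrite Eq at 1; field; lra).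
  rewrite Rabs_Ropp, Rabs_mult.
  assert (B : d * d / A <= h ^ 2 / eta ^ 3).
  { replace (h ^ 2 / eta ^ 3) with ((h / eta) * (h / eta) * / eta) by (field; lra).
    unfold Rdiv at 1; apply Rmult_le_compat.
    - nra.
    - apply Rlt_le, Rinv_0_lt_compat; auto.
    - apply Rmult_le_compat; auto.
    - apply Rinv_le_contravar; lra. }
  assert (B0 : 0 <= d * d / A).
  { apply Rmult_le_pos; [nra | apply Rlt_le, Rinv_0_lt_compat; auto]. }
  rewrite (Rabs_right (d * d / A)) by lra.
  apply Rmult_le_compat; auto; apply Rabs_pos.
Qed.

Lemma square_gap (h eta d : R) :
  0 < eta <= 1 -> 0 <= h -> 0 <= d <= h / eta -> d * d <= h ^ 2 / eta ^ 3.
Proof.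
  intros He Hh Hd.
  apply Rle_trans with (h / eta * (h / eta)).
  { apply Rmult_le_compat; lra. }
  replace (h ^ 2 / eta ^ 3) with (h / eta * (h / eta) * / eta) by (field; lra).
  assert (1 <= / eta) by (rewrite <- Rinv_1; apply Rinv_le_contravar; lra).
  nra.
Qed.

(** A common constant for the two consistency estimates, per unit of the mesh
    size 2 / N of the mean. Only its growth as a power of 1 / eta matters. *)
Definition consistency (T eta : R) : R := (8 * T ^ 2 + 8 * T + 2) / eta ^ 3.

Lemma consistency_pos (T eta : R) : 0 <= T -> 0 < eta -> 0 < consistency T eta.
Proof.
  intros HT Heta; unfold consistency, Rdiv.
  assert (0 < / eta ^ 3) by (apply Rinv_0_lt_compat, pow_lt; auto).
  assert (0 <= T ^ 2) by nra.
  apply Rmult_lt_0_compat; lra.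
Qed.

Lemma consistency_dominates (T h eta x m c : R) :
  0 < eta <= m -> m <= 1 -> 0 <= h -> x * h = 1 - m ->
  0 <= c <= 8 * T ^ 2 + 8 * T + 2 ->
  x * (c * (h ^ 2 / eta ^ 3)) <= h * consistency T eta.
Proof.
  intros Heta Hm Hh Exh Hc.
  replace (x * (c * (h ^ 2 / eta ^ 3))) with (x * h * (h * (c / eta ^ 3)))
    by (field; lra).
  rewrite Exh; unfold consistency.
  assert (0 < / eta ^ 3) by (apply Rinv_0_lt_compat, pow_lt; lra).
  assert (F : 0 <= c / eta ^ 3 <= (8 * T ^ 2 + 8 * T + 2) / eta ^ 3).
  { split; [apply Rmult_le_pos | apply Rmult_le_compat_r]; lra. }
  set (F1 := c / eta ^ 3) in *; clearbody F1.
  set (F2 := (8 * T ^ 2 + 8 * T + 2) / eta ^ 3) in *; clearbody F2.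
  assert (0 <= h * F1 <= h * F2)
    by (split; [apply Rmult_le_pos | apply Rmult_le_compat_l]; lra).
  nra.
Qed.

(** The limiting value of the majority state is - M. Here [x] is the number of
    players in the minority state, [h] the change of the mean when one of them
    moves, and x h = 1 - m, so that x (M' - M) approximates (1 - m) times the
    derivative of M in m and the x errors of order h^2 add up to order h. For
    [x = 0] the lemma is used with [h = 0]. *)
Lemma consistency_majority (T s m h eta x M M' : R) :
  0 <= s <= T -> 0 < eta <= m -> 0 <= h -> m + h <= 1 ->
  0 <= x -> x * h = 1 - m ->
  terminal_mean s m M -> terminal_mean s (m + h) M' ->
  Rabs (- ((1 - m) * jump s M / slope s M M) - x * jump s M' * (M - M'))
    <= h * consistency T eta.
Proof.
  intros Hs Heta Hh Hm Hx Exh R1 R2.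
  destruct (terminal_mean_space_expansion T s m h eta M M') as [D1 D2]; auto.
  assert (L1 : M <= 1) by (apply (terminal_mean_le_1 s m); auto; lra).
  assert (G1 : m <= slope s M M) by (apply (slope_ge s m m); auto; lra).
  destruct R1 as [P1 _], R2 as [P2 _].
  destruct (jump_diff s M M') as [c [Hc [Ec _]]]; try lra.
  assert (Hz := jump_bounds s M ltac:(lra) ltac:(lra)).
  set (d := M' - M) in *; set (k := h / slope s M M) in *.
  replace (- ((1 - m) * jump s M / slope s M M) - x * jump s M' * (M - M'))
    with (x * (2 * c * d * d + jump s M * (d - k))).
  2:{ rewrite <- Ec, <- Exh; unfold d, k; field; lra. }
  set (S := 4 * T ^ 2 + 2 * T) in *.
  assert (Hdd := square_gap h eta d ltac:(lra) ltac:(lra) D1).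
  set (w := h ^ 2 / eta ^ 3) in *.
  assert (Hw : 0 <= w) by nra.
  assert (HT : 0 <= T ^ 2) by nra.
  apply Rle_trans with (x * ((2 + 2 * S) * w)).
  - rewrite Rabs_mult, (Rabs_right x) by lra; apply Rmult_le_compat_l; auto.
    apply Rle_trans with (1 := Rabs_triang _ _).
    rewrite (Rabs_mult (jump s M)), (Rabs_right (jump s M)) by lra.
    assert (0 <= c * (d * d) <= w) by nra.
    rewrite (Rabs_right (2 * c * d * d)) by nra.
    pose proof (Rabs_pos (d - k)); nra.
  - apply (consistency_dominates T h eta x m); auto; unfold S; nra.
Qed.

(** The same estimate for the value - M + z of the minority state; the terms
    - z^2 / 2 on both sides have been cancelled. *)
Lemma consistency_minority (T s m h eta x M M' : R) :
  0 <= s <= T -> 0 < eta <= m -> 0 <= h -> m + h <= 1 ->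
  0 <= x -> x * h = 1 - m ->
  terminal_mean s m M -> terminal_mean s (m + h) M' ->
  Rabs ((1 - m) * jump s M / slope s M M * (2 * (/ (1 + s * M)) ^ 2 - 1)
        - x * jump s M * (- M' + jump s M' - (- M + jump s M)))
    <= h * consistency T eta.
Proof.
  intros Hs Heta Hh Hm Hx Exh R1 R2.
  destruct (terminal_mean_space_expansion T s m h eta M M') as [D1 D2]; auto.
  assert (L1 : M <= 1) by (apply (terminal_mean_le_1 s m); auto; lra).
  assert (G1 : m <= slope s M M) by (apply (slope_ge s m m); auto; lra).
  destruct R1 as [P1 _], R2 as [P2 _].
  destruct (jump_diff s M M') as [c [Hc [Ec Eq]]]; try lra.
  assert (Hz := jump_bounds s M ltac:(lra) ltac:(lra)).
  assert (Hi : 0 < / (1 + s * M) <= 1) by (apply inv_1_plus_bounds; nra).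
  set (c' := (/ (1 + s * M)) ^ 2) in *.
  assert (Hc' : 0 <= c' <= 1) by (unfold c'; nra).
  set (d := M' - M) in *; set (k := h / slope s M M) in *.
  replace ((1 - m) * jump s M / slope s M M * (2 * c' - 1)
        - x * jump s M * (- M' + jump s M' - (- M + jump s M)))
    with (x * (jump s M * ((k - d) * (2 * c' - 1) - 2 * (c - c') * d))).
  2:{ replace (- M' + jump s M' - (- M + jump s M)) with
        (jump s M' - jump s M - d) by (unfold d; ring).
      rewrite Ec, <- Exh; unfold k; field; lra. }
  set (S := 4 * T ^ 2 + 2 * T) in *.
  assert (Hdd := square_gap h eta d ltac:(lra) ltac:(lra) D1).
  set (w := h ^ 2 / eta ^ 3) in *.
  assert (Hw : 0 <= w) by nra.
  assert (HT : 0 <= T ^ 2) by nra.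
  apply Rle_trans with (x * ((4 * T + 2 * S) * w)).
  - rewrite Rabs_mult, (Rabs_right x) by lra; apply Rmult_le_compat_l; auto.
    rewrite Rabs_mult, (Rabs_right (jump s M)) by lra.
    rewrite (Rabs_right d) in Eq by lra.
    assert (A1 : Rabs ((k - d) * (2 * c' - 1)) <= S * w).
    { rewrite Rabs_mult, <- (Rmult_1_r (S * w)).
      apply Rmult_le_compat; try apply Rabs_pos.
      - rewrite Rabs_minus_sym; auto.
      - apply Rabs_le; lra. }
    assert (A2 : Rabs (2 * (c - c') * d) <= 2 * T * w).
    { rewrite !Rabs_mult, (Rabs_right 2), (Rabs_right d) by lra.
      apply Rle_trans with (2 * (s * d) * d); [nra |].
      assert (s * (d * d) <= T * w) by (apply Rmult_le_compat; nra); lra. }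
    assert (A3 := Rabs_triang ((k - d) * (2 * c' - 1)) (- (2 * (c - c') * d))).
    rewrite Rabs_Ropp in A3.
    change ((k - d) * (2 * c' - 1) + - (2 * (c - c') * d))
      with ((k - d) * (2 * c' - 1) - 2 * (c - c') * d) in A3.
    apply Rle_trans with (2 * (S * w + 2 * T * w)); [| lra].
    apply Rmult_le_compat; try lra; apply Rabs_pos.
  - apply (consistency_dominates T h eta x m); auto; unfold S; nra.
Qed.

(** * The (N+1)-player system: order of the values *)

(** States are indexed by the number [j] of players in one of the two states,
    the minority when 2j < N. [minor] is the value, in reversed time, of a player who is in that
    state too, and [major] that of a player in the other one. *)
Definition minor (T : R) (N : nat) (V : R -> R -> R) (j : nat) : R -> R :=
  reversed 0 T (fun t => V t (INR j / INR N)).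

Definition major (T : R) (N : nat) (V : R -> R -> R) (j : nat) : R -> R :=
  reversed 0 T (fun t => V t (1 - INR j / INR N)).

Definition gap (T : R) (N : nat) (V : R -> R -> R) (j : nat) (s : R) : R :=
  minor T N V j s - major T N V j s.

Lemma S_minor (N j : nat) : (j <= N)%nat -> S_ N (INR j / INR N).
Proof. intros Hj; exists j; auto. Qed.

Lemma S_major (N j : nat) :
  (1 <= N)%nat -> (j <= N)%nat -> S_ N (1 - INR j / INR N).
Proof.
  intros HN Hj; exists (N - j)%nat; split; [lia |].
  rewrite minus_INR by auto; field; apply not_0_INR; lia.
Qed.

Lemma major_minor (T : R) (N : nat) (V : R -> R -> R) (i j : nat) :
  (1 <= N)%nat -> (i + j = N)%nat -> major T N V j = minor T N V i.
Proof.
  intros HN E; unfold major, minor.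
  replace (1 - INR j / INR N) with (INR i / INR N); auto.
  rewrite <- E, plus_INR; field; rewrite <- plus_INR; apply not_0_INR; lia.
Qed.

Section Game.
Variables (T : R) (N : nat) (V : R -> R -> R).
Hypotheses (hT : 0 < T) (hN : (1 <= N)%nat) (hV : is_value T N V).

Let v := major T N V.
Let w := minor T N V.
Let z := gap T N V.

Lemma INR_N_pos : 0 < INR N.
Proof. apply lt_0_INR; lia. Qed.

Lemma minor_continuous (j : nat) (s : R) : (j <= N)%nat -> continuous (w j) s.
Proof.
  intros Hj; apply reversed_continuous; [lra |].
  apply hV, S_minor; auto.
Qed.

Lemma major_continuous (j : nat) (s : R) : (j <= N)%nat -> continuous (v j) s.
Proof.
  intros Hj; apply (reversed_continuous 0 T (fun t => V t (1 - INR j / INR N))); [lra |].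
  apply hV, S_major; auto.
Qed.

Lemma minor_bounds (j : nat) (s : R) :
  (j <= N)%nat -> 0 <= s <= T -> -1 <= w j s <= 1.
Proof.
  intros Hj Hs; unfold w, minor; rewrite reversed_eq by lra.
  apply hV; [lra | apply S_minor; auto].
Qed.

Lemma major_bounds (j : nat) (s : R) :
  (j <= N)%nat -> 0 <= s <= T -> -1 <= v j s <= 1.
Proof.
  intros Hj Hs; unfold v, major; rewrite reversed_eq by lra.
  apply hV; [lra | apply S_major; auto].
Qed.

Lemma minor_initial (j : nat) : (j <= N)%nat -> w j 0 = 1 - 2 * (INR j / INR N).
Proof.
  intros Hj; unfold w, minor; rewrite reversed_eq, Rminus_0_r by lra.
  destruct hV as [_ [_ [_ E]]]; rewrite E; [ring | apply S_minor; auto].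
Qed.

Lemma major_initial (j : nat) : (j <= N)%nat -> v j 0 = - (1 - 2 * (INR j / INR N)).
Proof.
  intros Hj; unfold v, major; rewrite reversed_eq, Rminus_0_r by lra.
  destruct hV as [_ [_ [_ E]]]; rewrite E; [ring | apply S_major; auto].
Qed.

Lemma minor_derive (j : nat) (s : R) : (j < N)%nat -> 0 < s < T ->
  is_derive (w j) s
    (- H (- z j s) + INR j * neg_part (- z j s) * (w (pred j) s - w j s)
     + (INR N - INR j) * neg_part (z (S j) s) * (w (S j) s - w j s)).
Proof.
  intros Hj Hs; pose proof INR_N_pos as HN0.
  destruct hV as [_ [_ [Hode _]]].
  destruct (Hode (T - s) (INR j / INR N)) as [E1 E2];
    [lra | apply S_minor; lia |].
  assert (D := reversed_derive 0 T (fun t => V t (INR j / INR N)) s ltac:(lra) E1).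
  match goal with |- is_derive _ _ ?r =>
    replace r with (- Derive (fun t => V t (INR j / INR N)) (T - s)); [exact D |] end.
  unfold z, gap, w, minor, major; rewrite !reversed_eq by lra.
  replace (1 - INR j / INR N - 1 / INR N) with (1 - INR (S j) / INR N) in E2
    by (rewrite S_INR; field; lra).
  replace (INR j / INR N + 1 / INR N) with (INR (S j) / INR N) in E2
    by (rewrite S_INR; field; lra).
  replace (INR N * (INR j / INR N)) with (INR j) in E2 by (field; lra).
  replace (INR N * (1 - INR j / INR N)) with (INR N - INR j) in E2 by (field; lra).
  rewrite Ropp_minus_distr.
  destruct j as [|j].
  - simpl (INR 0) in *; lra.
  - replace (INR (S j) / INR N - 1 / INR N) with (INR j / INR N) in E2
      by (rewrite S_INR; field; lra).
    simpl (pred (S j)); lra.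
Qed.

Lemma major_derive (j : nat) (s : R) : (j < N)%nat -> 0 < s < T ->
  is_derive (v j) s
    (- H (z j s) + (INR N - INR j) * neg_part (z j s) * (v (S j) s - v j s)
     + INR j * neg_part (- z (pred j) s) * (v (pred j) s - v j s)).
Proof.
  intros Hj Hs; pose proof INR_N_pos as HN0.
  destruct hV as [_ [_ [Hode _]]].
  destruct (Hode (T - s) (1 - INR j / INR N)) as [E1 E2];
    [lra | apply S_major; lia |].
  assert (D := reversed_derive 0 T (fun t => V t (1 - INR j / INR N)) s ltac:(lra) E1).
  match goal with |- is_derive _ _ ?r =>
    replace r with (- Derive (fun t => V t (1 - INR j / INR N)) (T - s)); [exact D |] end.
  unfold z, gap, v, minor, major; rewrite !reversed_eq by lra.
  replace (1 - (1 - INR j / INR N)) with (INR j / INR N) in E2 by ring.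
  replace (1 - INR j / INR N - 1 / INR N) with (1 - INR (S j) / INR N) in E2
    by (rewrite S_INR; field; lra).
  replace (INR N * (INR j / INR N)) with (INR j) in E2 by (field; lra).
  replace (INR N * (1 - INR j / INR N)) with (INR N - INR j) in E2 by (field; lra).
  rewrite Ropp_minus_distr.
  destruct j as [|j].
  - simpl (INR 0) in *; lra.
  - replace (INR (S j) / INR N - 1 / INR N) with (INR j / INR N) in E2
      by (rewrite S_INR; field; lra).
    replace (1 - INR (S j) / INR N + 1 / INR N) with (1 - INR j / INR N) in E2
      by (rewrite S_INR; field; lra).
    simpl (pred (S j)); lra.
Qed.

(** The family to be kept positive, indexed by pairs: [(j, true)] is the gap
    at [j], and [(j, false)] with [j >= 1] the increment of [v] at [j]. *)
Let P (i : nat * bool) : Prop :=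
  (2 * fst i < N)%nat /\ (snd i = false -> (1 <= fst i)%nat).

Let f (i : nat * bool) (s : R) : R :=
  if snd i then z (fst i) s else v (fst i) s - v (pred (fst i)) s.

(** In the ordered regime the value of the majority state cannot increase with
    reversed time, since the players who move make the majority larger, which lowers the
    cost of its members. *)
Lemma major_transport_nonpos (j : nat) (s : R) : (2 * j < N)%nat ->
  (forall i, P i -> 0 < f i s) ->
  INR j * neg_part (- z (pred j) s) * (v (pred j) s - v j s) <= 0.
Proof.
  intros Hj Hall; destruct j as [|j]; [simpl; lra |].
  simpl (pred (S j)).
  assert (H1 := Hall (j, true)); assert (H2 := Hall (S j, false)).
  unfold P, f in H1, H2; simpl fst in H1, H2; simpl snd in H1, H2.
  simpl (pred (S j)) in H2; cbv iota in H1, H2.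
  assert (Hz : 0 < z j s) by (apply H1; split; [lia | discriminate]).
  assert (Hd : 0 < v (S j) s - v j s) by (apply H2; split; [lia | intros; lia]).
  rewrite neg_part_of_nonpos by lra.
  pose proof (pos_INR (S j)).
  assert (0 <= INR (S j) * z j s) by (apply Rmult_le_pos; lra).
  nra.
Qed.

(** Nobody should leave the majority. This term vanishes when [S j] still is
    a minority or exactly one half. For N = 2j + 1, however, the move turns the
    minority into the majority, so that the roles are exchanged and the rate is
    the gap itself; the term is then of second order in the gap. *)
Lemma minor_outflow_ge (j : nat) (s : R) : (2 * j < N)%nat -> 0 <= s <= T ->
  (forall i, P i -> 0 < f i s) ->
  - 2 * INR N * z j s <=
    (INR N - INR j) * neg_part (z (S j) s) * (w (S j) s - w j s).
Proof.
  intros Hj Hs Hall.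
  assert (Hz : 0 < z j s) by (apply (Hall (j, true)); split; simpl; [lia | discriminate]).
  pose proof INR_N_pos as HN0.
  assert (Hzero : neg_part (z (S j) s) = 0 ->
    - 2 * INR N * z j s <=
    (INR N - INR j) * neg_part (z (S j) s) * (w (S j) s - w j s)).
  { intros E; rewrite E; nra. }
  (* S j is a minority, exactly one half, or the majority seen from j *)
  assert (C : (2 * S j < N \/ S j + S j = N \/ S j + j = N)%nat) by lia.
  destruct C as [C|[C|C]].
  - apply Hzero, neg_part_of_nonneg, Rlt_le.
    apply (Hall (S j, true)); split; simpl; [lia | discriminate].
  - apply Hzero, neg_part_of_nonneg.
    unfold z, gap; rewrite (major_minor T N V _ _ hN C); lra.
  - assert (Ez : z (S j) s = - z j s).
    { unfold z, gap; rewrite (major_minor T N V _ _ hN C).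
      rewrite (major_minor T N V j (S j)) by lia; lra. }
    rewrite Ez, neg_part_of_nonpos by lra.
    assert (Ew : w (S j) s - w j s = - z j s).
    { unfold z, gap, w; rewrite (major_minor T N V _ _ hN C); lra. }
    rewrite Ew.
    assert (B1 := minor_bounds j s ltac:(lia) Hs).
    assert (B2 := major_bounds j s ltac:(lia) Hs).
    assert (B3 : z j s <= 2) by (unfold z, gap; fold w v; lra).
    assert (B4 : INR j <= INR N) by (apply le_INR; lia).
    assert (B5 := pos_INR j); rewrite Ropp_involutive.
    assert (B6 : (INR N - INR j) * z j s <= INR N * 2) by (apply Rmult_le_compat; lra).
    nra.
Qed.

(** The two families are controlled together: monotonicity of [v] makes the
    transport term of [v] nonpositive, which keeps the gap [z] positive, and
    positivity of the gap preserves the monotonicity of [v]. *)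
Lemma ordered_families_positive (i : nat * bool) (s : R) :
  P i -> 0 <= s <= T -> 0 < f i s.
Proof.
  pose proof INR_N_pos as HN0.
  apply (positivity_propagates (nat * bool)
    (list_prod (seq 0 N) (true :: false :: nil)) P f (4 * INR N + 1) T).
  - intros [j b] [Hj _]; simpl in Hj; apply in_prod.
    + apply in_seq; lia.
    + destruct b; simpl; auto.
  - intros [j b] r [Hj _]; simpl in Hj; unfold f; simpl.
    destruct b.
    + apply (continuous_minus (w j) (v j));
        [apply minor_continuous | apply major_continuous]; lia.
    + apply (continuous_minus (v j) (v (pred j))); apply major_continuous; lia.
  - intros [j b] [Hj Hb]; simpl in Hj, Hb; unfold f; simpl.
    assert (F : INR j / INR N < 1 / 2).
    { apply (Rmult_lt_reg_r (INR N)); auto.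
      replace (INR j / INR N * INR N) with (INR j) by (field; lra).
      assert (Hj' : INR (2 * j) < INR N) by (apply lt_INR; lia).
      rewrite mult_INR in Hj'; simpl (INR 2) in Hj'; lra. }
    destruct b.
    + unfold z, gap; fold w v; rewrite minor_initial, major_initial by lia; lra.
    + rewrite !major_initial by lia.
      destruct j as [|j]; [specialize (Hb eq_refl); lia |].
      simpl (pred (S j)); rewrite S_INR.
      assert (0 < / INR N) by (apply Rinv_0_lt_compat; auto).
      unfold Rdiv; nra.
  - intros [j b] r [Hj Hb] Hr Hall; simpl in Hj, Hb.
    assert (Hnon := major_transport_nonpos j r Hj Hall).
    assert (Dv := major_derive j r ltac:(lia) Hr).
    assert (Hz : 0 < z j r) by (apply (Hall (j, true)); split; simpl; [lia | discriminate]).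
    assert (HjN : INR j <= INR N) by (apply le_INR; lia).
    pose proof (pos_INR j) as Hj0.
    assert (EH : H (z j r) = 0) by (unfold H; rewrite neg_part_of_nonneg by lra; field).
    rewrite EH, (neg_part_of_nonneg (z j r)) in Dv by lra.
    destruct b; unfold f; simpl fst; simpl snd; cbv iota.
    + assert (Hout := minor_outflow_ge j r Hj ltac:(lra) Hall).
      eexists; split.
      * apply (is_derive_minus (w j) (v j)); [apply minor_derive | exact Dv]; auto; lia.
      * unfold minus, plus, opp; simpl.
        assert (EH' : H (- z j r) = z j r ^ 2 / 2).
        { unfold H; rewrite neg_part_of_nonpos by lra; field. }
        rewrite EH', (neg_part_of_nonpos (- z j r)) by lra.
        assert (B1 := minor_bounds j r ltac:(lia) ltac:(lra)).
        assert (B2 := major_bounds j r ltac:(lia) ltac:(lra)).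
        assert (B0 := minor_bounds (pred j) r ltac:(lia) ltac:(lra)).
        assert (B3 : z j r <= 2) by (unfold z, gap; fold w v; lra).
        assert (B5 : - 2 * INR N * z j r <= INR j * z j r * (w (pred j) r - w j r)).
        { assert (0 <= INR j * z j r <= INR N * z j r) by nra; nra. }
        assert (B6 : z j r ^ 2 / 2 <= z j r) by nra.
        rewrite Ropp_involutive; lra.
    + destruct j as [|j]; [specialize (Hb eq_refl); lia |].
      simpl (pred (S j)) in *.
      assert (Hnon' := major_transport_nonpos j r ltac:(lia) Hall).
      assert (Dv' := major_derive j r ltac:(lia) Hr).
      assert (Hz' : 0 < z j r)
        by (apply (Hall (j, true)); split; simpl; [lia | discriminate]).
      assert (EH' : H (z j r) = 0) by (unfold H; rewrite neg_part_of_nonneg by lra; field).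
      rewrite EH', (neg_part_of_nonneg (z j r)) in Dv' by lra.
      eexists; split.
      * apply (is_derive_minus (v (S j)) (v j)); [exact Dv | exact Dv'].
      * unfold minus, plus, opp; simpl.
        rewrite (neg_part_of_nonpos (- z j r)) by lra.
        assert (Hd : 0 < v (S j) r - v j r).
        { apply (Hall (S j, false)); split; simpl; [lia | intros; lia]. }
        assert (B1 := minor_bounds j r ltac:(lia) ltac:(lra)).
        assert (B2 := major_bounds j r ltac:(lia) ltac:(lra)).
        assert (B3 : z j r <= 2) by (unfold z, gap; fold w v; lra).
        rewrite Ropp_involutive.
        change (match j with 0%nat => 1 | S _ => INR j + 1 end) with (INR (S j)).
        assert (B4 : 0 <= INR (S j) * z j r <= 2 * INR N) by nra.
        assert (B5 : INR (S j) * z j r * (v j r - v (S j) r)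
                     >= - (2 * INR N) * (v (S j) r - v j r)) by nra.
        nra.
Qed.

Lemma gap_positive (j : nat) (s : R) :
  (2 * j < N)%nat -> 0 <= s <= T -> 0 < z j s.
Proof.
  intros Hj Hs; apply (ordered_families_positive (j, true) s); auto.
  split; simpl; [auto | discriminate].
Qed.

Lemma gap_bounds (j : nat) (s : R) :
  (2 * j < N)%nat -> 0 <= s <= T -> 0 < z j s <= 2.
Proof.
  intros Hj Hs; split; [apply gap_positive; auto |].
  assert (B1 := minor_bounds j s ltac:(lia) ltac:(lra)).
  assert (B2 := major_bounds j s ltac:(lia) ltac:(lra)).
  unfold z, gap; fold w v; lra.
Qed.

(** Once the signs are known, the equations for [j] involve [j] and [pred j]
    only. The minority never grows, so the values far from one half never see
    the region where the limit is discontinuous. *)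
Lemma major_derive_triangular (j : nat) (s : R) :
  (2 * j < N)%nat -> 0 < s < T ->
  is_derive (v j) s (INR j * z (pred j) s * (v (pred j) s - v j s)).
Proof.
  intros Hj Hs.
  assert (Hz := gap_positive j s Hj ltac:(lra)).
  assert (Hz' := gap_positive (pred j) s ltac:(lia) ltac:(lra)).
  assert (D := major_derive j s ltac:(lia) Hs).
  unfold H in D.
  rewrite !(neg_part_of_nonneg (z j s)), (neg_part_of_nonpos (- z (pred j) s)) in D by lra.
  match type of D with is_derive _ _ ?r =>
    replace r with (INR j * z (pred j) s * (v (pred j) s - v j s)) in D by field end.
  exact D.
Qed.

Lemma minor_derive_triangular (j : nat) (s : R) :
  (2 * S j <= N)%nat -> 0 < s < T ->
  is_derive (w j) s (- z j s ^ 2 / 2 + INR j * z j s * (w (pred j) s - w j s)).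
Proof.
  intros Hj Hs.
  assert (Hz := gap_positive j s ltac:(lia) ltac:(lra)).
  assert (Hz' : 0 <= z (S j) s).
  { destruct (Nat.eq_dec (2 * S j) N) as [E|E].
    - unfold z, gap; rewrite (major_minor T N V (S j) (S j)) by lia; lra.
    - apply Rlt_le, gap_positive; [lia | lra]. }
  assert (D := minor_derive j s ltac:(lia) Hs).
  unfold H in D.
  rewrite (neg_part_of_nonneg (z (S j) s)), !(neg_part_of_nonpos (- z j s)) in D by lra.
  match type of D with is_derive _ _ ?r =>
    replace r with (- z j s ^ 2 / 2 + INR j * z j s * (w (pred j) s - w j s)) in D by field end.
  exact D.
Qed.

End Game.

(** * Comparison of the two systems *)

(** At a positive mean [m] this is the limit of the majority value, and at
    [- m] that of the minority value. *)
Definition limit_value (T : R) (U : R -> state -> R -> R) (m : R) : R -> R :=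
  reversed 0 T (fun t => U t Defs.plus m).

Lemma limit_value_characterized (T : R) (U : R -> state -> R -> R) (m s : R) :
  is_entropy_master T U -> 0 < m <= 1 -> 0 <= s <= T ->
  terminal_mean s m (- limit_value T U m s) /\
  limit_value T U (- m) s = limit_value T U m s + jump s (- limit_value T U m s).
Proof.
  intros hU Hm Hs; unfold limit_value; rewrite !reversed_eq by lra.
  destruct (entropy_master_explicit T U s m) as [M [R1 [E1 E2]]]; auto.
  rewrite E1, E2, Ropp_involutive; split; auto.
Qed.

Lemma limit_value_bounds (T : R) (U : R -> state -> R -> R) (m s : R) :
  is_entropy_master T U -> 0 < m <= 1 -> 0 <= s <= T ->
  -1 <= limit_value T U m s <= 1 /\ -1 <= limit_value T U (- m) s <= 1.
Proof.
  intros hU Hm Hs.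
  destruct (limit_value_characterized T U m s) as [R1 E]; auto.
  assert (L := terminal_mean_le_1 s m _ (proj1 Hs) (proj2 Hm) R1).
  destruct R1 as [P _]; rewrite E.
  set (M := - limit_value T U m s) in *.
  replace (limit_value T U m s) with (- M) by (unfold M; ring).
  assert (B := jump_bounds s M (proj1 Hs) ltac:(lra)).
  assert (HsM : 0 <= s * M) by nra.
  assert (jump s M <= 2 * M).
  { unfold jump; apply (Rmult_le_reg_r (1 + s * M)); [lra |].
    replace (2 * M / (1 + s * M) * (1 + s * M)) with (2 * M) by (field; lra).
    nra. }
  lra.
Qed.

Lemma limit_value_continuous (T : R) (U : R -> state -> R -> R) (m : R) :
  0 <= T -> is_entropy_master T U -> 0 < m <= 1 ->
  forall s, continuous (limit_value T U m) s.
Proof.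
  intros HT hU Hm; apply reversed_continuous; auto.
  apply lipschitz_continuous_on with (K := (2 + 2 * T) / m).
  intros t t' Ht Ht'.
  destruct (limit_value_characterized T U m (T - t)) as [R1 _]; auto; [lra |].
  destruct (limit_value_characterized T U m (T - t')) as [R2 _]; auto; [lra |].
  assert (E := terminal_mean_lipschitz_time T (T - t) (T - t') m _ _
                 ltac:(lra) ltac:(lra) Hm R1 R2).
  unfold limit_value in E; rewrite !reversed_eq in E by lra.
  replace (T - (T - t)) with t in E by ring.
  replace (T - (T - t')) with t' in E by ring.
  replace (T - t' - (T - t)) with (- (t' - t)) in E by ring.
  replace (- U t' Defs.plus m - - U t Defs.plus m) with (- (U t' Defs.plus m - U t Defs.plus m))
    in E by ring.
  rewrite !Rabs_Ropp in E; auto.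
Qed.

(** The formula - M + 2M / (1 + s M) is only valid, and its denominator only
    known to be positive, for s in [0,T]; hence the clamped time c. *)
Lemma limit_value_opp_continuous (T : R) (U : R -> state -> R -> R) (m : R) :
  0 <= T -> is_entropy_master T U -> 0 < m <= 1 ->
  forall s, continuous (limit_value T U (- m)) s.
Proof.
  intros HT hU Hm s.
  set (c := fun s => Rmax 0 (Rmin (T - 0) s)).
  set (M := fun s => - limit_value T U m s).
  assert (Hc : forall s, 0 <= c s <= T).
  { intros r; pose proof (clamp_bounds (T - 0) r); unfold c; lra. }
  assert (HF : forall m s, limit_value T U m s = limit_value T U m (c s)).
  { intros m' r; unfold limit_value; rewrite (reversed_eq _ _ _ (c r)); auto.
    pose proof (Hc r); lra. }
  assert (HM : forall s, terminal_mean (c s) m (M s)).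
  { intros r; unfold M; rewrite HF; apply limit_value_characterized; auto. }
  assert (Cc : continuous c s).
  { assert (Ec : forall r, reversed 0 T (fun t => T - t) r = c r)
      by (intros r; unfold reversed, c; ring).
    apply (continuous_ext _ _ _ Ec).
    apply reversed_continuous; auto.
    apply lipschitz_continuous_on with (K := 1); intros x y _ _.
    replace (T - y - (T - x)) with (- (y - x)) by ring.
    rewrite Rabs_Ropp; lra. }
  assert (CM : continuous M s)
    by (apply (continuous_opp (limit_value T U m)), limit_value_continuous; auto).
  assert (EF : forall r, - M r + 2 * M r * / (1 + c r * M r) = limit_value T U (- m) r).
  { intros r; rewrite (HF (- m)).
    destruct (limit_value_characterized T U m (c r) hU Hm (Hc r)) as [_ E].
    rewrite E, <- HF; unfold M, jump, Rdiv; ring. }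
  apply (continuous_ext _ _ _ EF).
  apply (continuous_plus (fun s => - M s) (fun s => 2 * M s * / (1 + c s * M s))).
  - apply (continuous_opp M); auto.
  - apply (continuous_mult (fun s => 2 * M s) (fun s => / (1 + c s * M s))).
    + apply (continuous_scal_r 2 M); auto.
    + apply continuous_Rinv_comp.
      * apply (continuous_plus (fun _ => 1) (fun s => c s * M s)).
        -- apply continuous_const.
        -- apply (continuous_mult c M); auto.
      * destruct (HM s) as [P _].
        assert (0 <= c s * M s) by (apply Rmult_le_pos; [apply Hc | lra]); lra.
Qed.

Lemma limit_value_derive (T : R) (U : R -> state -> R -> R) (m s : R) :
  is_entropy_master T U -> 0 < m <= 1 -> 0 < s < T ->
  is_derive (limit_value T U m) s
    (- ((1 - m) * jump s (- limit_value T U m s)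
        / slope s (- limit_value T U m s) (- limit_value T U m s))).
Proof.
  intros hU Hm Hs.
  set (M := fun s => - limit_value T U m s).
  assert (D := terminal_mean_derive_time T s m M Hs Hm
                 (fun r Hr => proj1 (limit_value_characterized T U m r hU Hm Hr))).
  assert (EM : forall r, - M r = limit_value T U m r) by (intros r; unfold M; ring).
  apply (is_derive_ext _ _ _ _ EM).
  apply (is_derive_opp M); exact D.
Qed.

Lemma limit_value_opp_derive (T : R) (U : R -> state -> R -> R) (m s : R) :
  is_entropy_master T U -> 0 < m <= 1 -> 0 < s < T ->
  is_derive (limit_value T U (- m)) s
    (let M := - limit_value T U m s in
     - jump s M ^ 2 / 2
     + (1 - m) * jump s M / slope s M M * (2 * (/ (1 + s * M)) ^ 2 - 1)).
Proof.
  intros hU Hm Hs.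
  set (M := fun s => - limit_value T U m s).
  assert (D := terminal_mean_derive_time T s m M Hs Hm
                 (fun r Hr => proj1 (limit_value_characterized T U m r hU Hm Hr))).
  assert (EM : forall r, 0 < r < T ->
    - M r + 2 * M r / (1 + r * M r) = limit_value T U (- m) r).
  { intros r Hr; destruct (limit_value_characterized T U m r hU Hm ltac:(lra)) as [_ E].
    rewrite E; unfold M, jump; ring. }
  apply (is_derive_ext_loc _ _ _ _ (locally_between 0 T s _ Hs EM)).
  change (- limit_value T U m s) with (M s).
  destruct (limit_value_characterized T U m s hU Hm ltac:(lra)) as [[P _] _].
  change (- limit_value T U m s) with (M s) in P.
  assert (0 < s * M s) by (apply Rmult_lt_0_compat; lra).
  auto_derive.
  - repeat split; try (eexists; exact D); lra.
  - replace (Derive (fun x : R => M x) s)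
      with ((1 - m) * (2 * M s / (1 + s * M s)) / slope s (M s) (M s))
      by (symmetry; apply (is_derive_unique M s _ D)).
    cbv zeta; fold (jump s (M s)).
    set (d := (1 - m) * jump s (M s) / slope s (M s) (M s)).
    unfold jump; field; lra.
Qed.

Definition mean (N j : nat) : R := 1 - 2 * (INR j / INR N).

(** The case [j = 0], where [pred j = j], is covered by [h = 0]: the
    fraction of minority players is then zero too. *)
Lemma mean_pred (N j : nat) : (1 <= N)%nat ->
  exists h, 0 <= h <= 2 / INR N /\ mean N (pred j) = mean N j + h /\
    INR j * h = 1 - mean N j.
Proof.
  intros HN; assert (HN0 := INR_N_pos N HN).
  assert (0 < / INR N) by (apply Rinv_0_lt_compat; auto).
  destruct j as [|j].
  - exists 0; unfold mean; simpl; unfold Rdiv; split; [lra | split; ring].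
  - exists (2 / INR N); unfold mean; simpl (pred (S j)); rewrite S_INR.
    split; [unfold Rdiv; lra | split; field; lra].
Qed.

Lemma mean_half (N j : nat) (eta : R) : (1 <= N)%nat ->
  2 / INR N <= eta -> eta <= mean N j -> (2 * S j <= N)%nat.
Proof.
  intros HN H1 H2; assert (HN0 := INR_N_pos N HN).
  apply INR_le; rewrite mult_INR, (S_INR j); simpl (INR 2).
  unfold mean in H2.
  apply (Rmult_le_reg_r (/ INR N)); [apply Rinv_0_lt_compat; auto |].
  rewrite Rinv_r by lra; unfold Rdiv in *; lra.
Qed.

Lemma Rabs_triang3 (a b c A B C : R) :
  Rabs a <= A -> Rabs b <= B -> Rabs c <= C -> Rabs (a + b + c) <= A + B + C.
Proof.
  intros Ha Hb Hc; apply Rabs_le_between in Ha, Hb, Hc; apply Rabs_le; lra.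
Qed.

Lemma Rabs_mult_le (a b A B : R) :
  Rabs a <= A -> Rabs b <= B -> Rabs (a * b) <= A * B.
Proof.
  intros Ha Hb; rewrite Rabs_mult; apply Rmult_le_compat; auto; apply Rabs_pos.
Qed.

(** The number of players compensates the mesh size: x (M' - M) stays bounded
    uniformly in N. *)
Lemma scaled_increment (T s m h eta x M M' : R) :
  0 <= s <= T -> 0 < eta <= m -> 0 <= h -> m + h <= 1 ->
  0 <= x -> x * h = 1 - m ->
  terminal_mean s m M -> terminal_mean s (m + h) M' ->
  0 <= x * (M' - M) <= / eta.
Proof.
  intros Hs Heta Hh Hm Hx Exh R1 R2.
  destruct (terminal_mean_space_expansion T s m h eta M M') as [[D1 D2] _]; auto.
  split; [apply Rmult_le_pos; lra |].
  apply Rle_trans with (x * (h / eta)); [apply Rmult_le_compat_l; lra |].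
  replace (x * (h / eta)) with (x * h * / eta) by (unfold Rdiv; ring).
  assert (0 < / eta) by (apply Rinv_0_lt_compat; lra).
  rewrite Exh; nra.
Qed.

(** What remains of the equation for the limit when the rates of the game are
    put in place of those of the limit: the difference of the rates, times a
    bounded increment, and the consistency error. *)
Lemma majority_defect (T s m h eta x M M' Z e : R) :
  0 <= s <= T -> 0 < eta <= m -> 0 <= h -> m + h <= 1 ->
  0 <= x -> x * h = 1 - m ->
  terminal_mean s m M -> terminal_mean s (m + h) M' ->
  Rabs (Z - jump s M') <= 2 * e ->
  Rabs (x * Z * (M - M') - - ((1 - m) * jump s M / slope s M M))
    <= (4 + 2 / eta) * e + h * consistency T eta.
Proof.
  intros Hs Heta Hh Hm Hx Exh R1 R2 HZ.
  assert (Hc := consistency_majority T s m h eta x M M' Hs Heta Hh Hm Hx Exh R1 R2).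
  assert (Hd := scaled_increment T s m h eta x M M' Hs Heta Hh Hm Hx Exh R1 R2).
  assert (He := Rabs_pos (Z - jump s M')).
  assert (0 < / eta) by (apply Rinv_0_lt_compat; lra).
  replace (x * Z * (M - M') - - ((1 - m) * jump s M / slope s M M))
    with (- (x * (M' - M)) * (Z - jump s M')
          + - (- ((1 - m) * jump s M / slope s M M) - x * jump s M' * (M - M')) + 0)
    by ring.
  apply Rle_trans with (/ eta * (2 * e) + h * consistency T eta + 0).
  - apply Rabs_triang3; [| rewrite Rabs_Ropp; auto | rewrite Rabs_R0; lra].
    apply Rabs_mult_le; auto.
    rewrite Rabs_Ropp, Rabs_right; lra.
  - unfold Rdiv; nra.
Qed.

Lemma minority_defect (T s m h eta x M M' Z e : R) :
  0 <= s <= T -> 0 < eta <= m -> 0 <= h -> m + h <= 1 ->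
  0 <= x -> x * h = 1 - m ->
  terminal_mean s m M -> terminal_mean s (m + h) M' ->
  0 <= Z <= 2 -> Rabs (Z - jump s M) <= 2 * e ->
  Rabs (- Z ^ 2 / 2 + x * Z * (- M' + jump s M' - (- M + jump s M))
        - (- jump s M ^ 2 / 2
           + (1 - m) * jump s M / slope s M M * (2 * (/ (1 + s * M)) ^ 2 - 1)))
    <= (4 + 2 / eta) * e + h * consistency T eta.
Proof.
  intros Hs Heta Hh Hm Hx Exh R1 R2 HZ2 HZ.
  assert (Hc := consistency_minority T s m h eta x M M' Hs Heta Hh Hm Hx Exh R1 R2).
  assert (Hd := scaled_increment T s m h eta x M M' Hs Heta Hh Hm Hx Exh R1 R2).
  assert (He := Rabs_pos (Z - jump s M)).
  assert (0 < / eta) by (apply Rinv_0_lt_compat; lra).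
  assert (L1 : M <= 1) by (apply (terminal_mean_le_1 s m); auto; lra).
  destruct R1 as [P1 _], R2 as [P2 _].
  assert (J := jump_bounds s M ltac:(lra) ltac:(lra)).
  destruct (jump_diff s M M') as [c [Hc1 [Hc2 _]]]; try lra.
  set (D := (1 - m) * jump s M / slope s M M * (2 * (/ (1 + s * M)) ^ 2 - 1)) in *.
  set (z := jump s M) in *.
  replace (jump s M') with (z + 2 * c * (M' - M)) in * by lra.
  replace (- Z ^ 2 / 2 + x * Z * (- M' + (z + 2 * c * (M' - M)) - (- M + z))
           - (- z ^ 2 / 2 + D))
    with (- ((Z + z) / 2) * (Z - z) + x * (M' - M) * (2 * c - 1) * (Z - z)
          + - (D - x * z * (- M' + (z + 2 * c * (M' - M)) - (- M + z))))
    by field.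
  apply Rle_trans with (2 * (2 * e) + / eta * 1 * (2 * e) + h * consistency T eta).
  - apply Rabs_triang3; [| | rewrite Rabs_Ropp; auto].
    + apply Rabs_mult_le; auto; apply Rabs_le; lra.
    + apply Rabs_mult_le; auto; apply Rabs_mult_le.
      * rewrite Rabs_right; lra.
      * apply Rabs_le; lra.
  - unfold Rdiv; nra.
Qed.

(** The errors of both states satisfy a transport equation with the rates of
    the game, with a source of size (4 + 2 / eta) * error + O(1 / N), and vanish
    at reversed time 0. The indices with mean at least eta are closed under
    [pred], so Gronwall's inequality applies to them alone. *)
Lemma values_close_to_limits (T : R) (U : R -> state -> R -> R) (N : nat)
  (V : R -> R -> R) (eta : R) (j : nat) (s : R) :
  0 < T -> is_entropy_master T U -> (1 <= N)%nat -> is_value T N V ->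
  0 < eta -> 2 / INR N <= eta -> eta <= mean N j -> 0 <= s <= T ->
  let B := 2 * (2 / INR N * consistency T eta) * exp ((4 + 2 / eta + 1) * s) in
  Rabs (major T N V j s - limit_value T U (mean N j) s) <= B /\
  Rabs (minor T N V j s - limit_value T U (- mean N j) s) <= B.
Proof.
  intros hT hU HN hV Heta HNeta Hmj Hs B.
  assert (HN0 := INR_N_pos N HN).
  assert (HiN : 0 < / INR N) by (apply Rinv_0_lt_compat; auto).
  assert (Hie : 0 < / eta) by (apply Rinv_0_lt_compat; auto).
  set (P := fun i : nat * bool => eta <= mean N (fst i)).
  set (y := fun (i : nat * bool) s =>
    if snd i then major T N V (fst i) s - limit_value T U (mean N (fst i)) s
    else minor T N V (fst i) s - limit_value T U (- mean N (fst i)) s).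
  assert (Pj : forall k, eta <= mean N k ->
    (2 * S k <= N)%nat /\ eta <= mean N k <= 1 /\ eta <= mean N (pred k) <= 1).
  { assert (Hle : forall k, mean N k <= 1).
    { intros k; unfold mean, Rdiv; pose proof (pos_INR k); nra. }
    intros k Hk; split; [apply (mean_half N k eta); auto |].
    destruct (mean_pred N k HN) as [h [Hh [E1 _]]].
    pose proof (Hle k); pose proof (Hle (pred k)); lra. }
  assert (Hgw : forall i s, P i -> 0 <= s <= T ->
    Rabs (y i s) <= 2 * (2 / INR N * consistency T eta) * exp ((4 + 2 / eta + 1) * s)).
  { apply (transport_gronwall (nat * bool) (list_prod (seq 0 N) (true :: false :: nil))
             P (fun i => (pred (fst i), snd i)) y (2 * INR N)).
    - unfold Rdiv; nra.
    - apply Rmult_lt_0_compat; [unfold Rdiv; lra | apply consistency_pos; lra].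
    - intros [k b] Hk; destruct (Pj k Hk) as [H1 _]; apply in_prod.
      + apply in_seq; lia.
      + destruct b; simpl; auto.
    - intros [k b] Hk; destruct (Pj k Hk) as [_ [_ H1]]; unfold P; simpl; lra.
    - intros [k b] r Hk; destruct (Pj k Hk) as [H1 [H2 _]].
      unfold y; simpl; destruct b.
      + apply (continuous_minus (major T N V k) (limit_value T U (mean N k))).
        * apply major_continuous; auto; lia.
        * apply limit_value_continuous; auto; lra.
      + apply (continuous_minus (minor T N V k) (limit_value T U (- mean N k))).
        * apply minor_continuous; auto; lia.
        * apply limit_value_opp_continuous; auto; lra.
    - intros [k b] Hk; destruct (Pj k Hk) as [H1 [H2 _]].
      destruct (limit_value_characterized T U (mean N k) 0) as [[_ R1] E]; auto; try lra.
      assert (Ef : limit_value T U (mean N k) 0 = - mean N k) by lra.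
      unfold y; simpl; destruct b.
      + rewrite Ef, major_initial by (auto; lia); unfold mean; lra.
      + rewrite E, Ef, minor_initial by (auto; lia); unfold mean, jump; field; lra.
    - intros [k b] r e Hk Hr Hall; simpl fst; simpl snd.
      destruct (Pj k Hk) as [H1 [H2 H3]].
      assert (H1' : (2 * S (pred k) <= N)%nat) by lia.
      destruct (mean_pred N k HN) as [h [Hh [Eh1 Eh2]]].
      set (fv := fun i => limit_value T U (mean N i) r).
      set (fw := fun i => limit_value T U (- mean N i) r).
      assert (HZ : forall i, eta <= mean N i ->
        Rabs (gap T N V i r - jump r (- fv i)) <= 2 * e).
      { intros i Hi; destruct (Pj i Hi) as [_ [Hi' _]].
        assert (A1 := Hall (i, true) Hi); assert (A2 := Hall (i, false) Hi).
        unfold y in A1, A2; simpl in A1, A2.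
        destruct (limit_value_characterized T U (mean N i) r) as [_ E]; auto; try lra.
        rewrite E in A2; unfold gap, fv.
        apply Rabs_le_between in A1, A2; apply Rabs_le; lra. }
      destruct (limit_value_characterized T U (mean N k) r) as [R1 E1]; auto; try lra.
      destruct (limit_value_characterized T U (mean N (pred k)) r) as [R2 E2]; auto; try lra.
      fold (fv k) in R1, E1; fold (fv (pred k)) in R2, E2.
      fold (fw k) in E1; fold (fw (pred k)) in E2.
      rewrite Eh1 in R2.
      assert (HkN : INR k <= INR N) by (apply le_INR; lia).
      assert (Hk0 := pos_INR k).
      assert (HK : h * consistency T eta <= 2 / INR N * consistency T eta).
      { apply Rmult_le_compat_r; [apply Rlt_le, consistency_pos |]; lra. }
      destruct b.
      + exists (INR k * gap T N V (pred k) r); eexists; split; [| split].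
        * assert (G := gap_bounds T N V hT HN hV (pred k) r ltac:(lia) ltac:(lra)).
          split; [nra |].
          rewrite (Rmult_comm 2); apply Rmult_le_compat; lra.
        * apply (is_derive_minus (major T N V k) (limit_value T U (mean N k))).
          -- apply major_derive_triangular; auto; lia.
          -- apply limit_value_derive; auto; lra.
        * assert (Hdef := majority_defect T r (mean N k) h eta (INR k)
            (- fv k) (- fv (pred k)) _ e ltac:(lra) ltac:(lra) ltac:(lra) ltac:(lra)
            Hk0 Eh2 R1 R2 (HZ (pred k) (proj1 H3))).
          eapply Rle_trans; [| apply Rplus_le_compat_l, HK].
          eapply Rle_trans; [right | exact Hdef]; f_equal.
          unfold minus, plus, opp, y; simpl; unfold fv; ring.
      + assert (G := gap_bounds T N V hT HN hV k r ltac:(lia) ltac:(lra)).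
        exists (INR k * gap T N V k r); eexists; split; [| split].
        * split; [nra |].
          rewrite (Rmult_comm 2); apply Rmult_le_compat; lra.
        * apply (is_derive_minus (minor T N V k) (limit_value T U (- mean N k))).
          -- apply minor_derive_triangular; auto; lia.
          -- apply limit_value_opp_derive; auto; lra.
        * assert (Hdef := minority_defect T r (mean N k) h eta (INR k)
            (- fv k) (- fv (pred k)) (gap T N V k r) e
            ltac:(lra) ltac:(lra) ltac:(lra) ltac:(lra)
            Hk0 Eh2 R1 R2 ltac:(lra) (HZ k (proj1 H2))).
          eapply Rle_trans; [| apply Rplus_le_compat_l, HK].
          eapply Rle_trans; [right | exact Hdef]; f_equal.
          unfold minus, plus, opp, y; simpl.
          fold (fv k) (fw k) (fw (pred k)); rewrite E1, E2; unfold Rdiv; ring. }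
  split.
  - apply (Hgw (j, true) s); auto.
  - apply (Hgw (j, false) s); auto.
Qed.

(** * The rate of convergence *)

(** The first term covers the small games with N < 1 / eps, for which the
    bound by 2 on the difference is enough, and makes the constant diverge. *)
Definition rate_constant (T eps : R) : R :=
  2 / eps + 4 * consistency T (2 * eps) * exp ((5 + / eps) * T).

Lemma rate_constant_diverges (T : R) : 0 <= T ->
  filterlim (rate_constant T) (at_right 0) (Rbar_locally p_infty).
Proof.
  intros HT.
  apply (filterlim_ge_p_infty Rinv); [| apply filterlim_Rinv_0_right].
  exists (mkposreal 1 Rlt_0_1); intros eps _ Heps.
  assert (0 < / eps) by (apply Rinv_0_lt_compat; auto).
  assert (H1 := consistency_pos T (2 * eps) HT ltac:(lra)).
  assert (H2 := exp_pos ((5 + / eps) * T)).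
  unfold rate_constant, Rdiv; nra.
Qed.

(** For N >= 1 / eps the indices at distance eps from one half also satisfy
    2 (j + 1) <= N, as the triangular equations require. *)
Lemma rate_bound (T : R) (U : R -> state -> R -> R) (N : nat) (V : R -> R -> R)
  (eps : R) (j : nat) (s : R) :
  0 < T -> is_entropy_master T U -> (1 <= N)%nat -> is_value T N V ->
  0 < eps -> (j <= N)%nat -> 2 * eps <= mean N j -> 0 <= s <= T ->
  Rabs (major T N V j s - limit_value T U (mean N j) s) <= rate_constant T eps / INR N /\
  Rabs (minor T N V j s - limit_value T U (- mean N j) s) <= rate_constant T eps / INR N.
Proof.
  intros hT hU HN hV Heps Hj Hm Hs.
  assert (HN0 := INR_N_pos N HN).
  assert (HiN : 0 < / INR N) by (apply Rinv_0_lt_compat; auto).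
  assert (Hie : 0 < / eps) by (apply Rinv_0_lt_compat; auto).
  assert (HK := consistency_pos T (2 * eps) (Rlt_le _ _ hT) ltac:(lra)).
  assert (HX := exp_pos ((5 + / eps) * T)).
  assert (Hrest : 0 < 4 * consistency T (2 * eps) * exp ((5 + / eps) * T)).
  { apply Rmult_lt_0_compat; lra. }
  unfold rate_constant, Rdiv.
  destruct (Rle_lt_dec (1 / INR N) eps) as [Hbig|Hsmall].
  - assert (HX' : exp ((4 + 2 / (2 * eps) + 1) * s) <= exp ((5 + / eps) * T)).
    { replace (4 + 2 / (2 * eps) + 1) with (5 + / eps) by (field; lra).
      assert (E : (5 + / eps) * s <= (5 + / eps) * T) by (apply Rmult_le_compat_l; lra).
      destruct E as [E|E]; [apply Rlt_le, exp_increasing; auto | rewrite E; lra]. }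
    destruct (values_close_to_limits T U N V (2 * eps) j s) as [B1 B2]; auto;
      [lra | unfold Rdiv in *; lra |].
    set (X := exp ((4 + 2 / (2 * eps) + 1) * s)) in *.
    set (Y := exp ((5 + / eps) * T)) in *.
    assert (F : 2 * (2 / INR N * consistency T (2 * eps)) * X <=
      (2 * / eps + 4 * consistency T (2 * eps) * Y) * / INR N).
    { replace (2 * (2 / INR N * consistency T (2 * eps)) * X)
        with ((4 * consistency T (2 * eps) * X) * / INR N) by (field; lra).
      apply Rmult_le_compat_r; [lra |].
      assert (4 * consistency T (2 * eps) * X <= 4 * consistency T (2 * eps) * Y)
        by (apply Rmult_le_compat_l; lra).
      lra. }
    split; eapply Rle_trans; eauto.
  - assert (Hm1 : mean N j <= 1).
    { unfold mean, Rdiv; pose proof (pos_INR j); nra. }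
    destruct (limit_value_bounds T U (mean N j) s) as [B1 B2]; auto; [lra |].
    assert (B3 := major_bounds T N V HN hV j s Hj Hs).
    assert (B4 := minor_bounds T N V hV j s Hj Hs).
    assert (F : 2 <= (2 * / eps
      + 4 * consistency T (2 * eps) * exp ((5 + / eps) * T)) * / INR N).
    { assert (G : 1 < / eps * / INR N).
      { apply (Rmult_lt_reg_l eps); auto.
        replace (eps * (/ eps * / INR N)) with (1 / INR N) by (field; lra).
        rewrite Rmult_1_r; auto. }
      nra. }
    split; (eapply Rle_trans; [| exact F]); apply Rabs_le; lra.
Qed.

Theorem theorem8 (T : R) (hT : 0 < T)
  (U : R -> state -> R -> R) (hU : is_entropy_master T U) :
  exists C : R -> R,
    filterlim C (at_right 0) (Rbar_locally p_infty) /\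
    forall eps : R, 0 < eps ->
    forall (N : nat) (V : R -> R -> R), (1 <= N)%nat -> is_value T N V ->
    forall t mu : R, 0 <= t <= T -> S_ N mu ->
      ~ (1 / 2 - eps < mu < 1 / 2 + eps) ->
      Rabs (V t mu - U_star U t mu) <= C eps / INR N.
Proof.
  exists (rate_constant T); split; [apply rate_constant_diverges; lra |].
  intros eps Heps N V HN hV t mu Ht [k [Hk Emu]] Hmu.
  assert (HN0 := INR_N_pos N HN).
  unfold U_star.
  destruct (Rlt_le_dec mu (1 / 2)) as [Hlow|Hhigh].
  - assert (Hm : 2 * eps <= mean N k).
    { unfold mean; rewrite <- Emu; apply Rnot_lt_le; intros F; apply Hmu; lra. }
    destruct (rate_bound T U N V eps k (T - t)) as [_ B]; auto; [lra |].
    unfold minor, limit_value in B; rewrite !reversed_eq in B by lra.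
    replace (T - (T - t)) with t in B by ring.
    rewrite Emu; replace (2 * (INR k / INR N) - 1) with (- mean N k)
      by (unfold mean; ring); auto.
  - assert (Ek : INR (N - k) / INR N = 1 - mu).
    { rewrite Emu, minus_INR by auto; field; lra. }
    assert (Hm : 2 * eps <= mean N (N - k)).
    { unfold mean; rewrite Ek; apply Rnot_lt_le; intros F; apply Hmu; lra. }
    destruct (rate_bound T U N V eps (N - k) (T - t)) as [B _]; auto; [lia | lra |].
    unfold major, limit_value in B; rewrite !reversed_eq in B by lra.
    replace (T - (T - t)) with t in B by ring.
    replace (mean N (N - k)) with (2 * mu - 1) in B by (unfold mean; rewrite Ek; ring).
    rewrite Ek in B; replace (1 - (1 - mu)) with mu in B by ring; auto.
Qed.
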